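(* Let $\mathfrak{A}$ be a unital $C^*$-algebra, let $k$ be a positive integer and let $a_i\in\mathfrak{A}$ for all $i\in\{1,2,\ldots,k\}$. Then for all $n\geq1$, $$dw_{\mathfrak{A}}^{4n}\left(\sum_{i=1}^{k}a_i\right)\leq2^{2n-2}k^{4n-1}\sum_{i=1}^{k}w_{\mathfrak{A}}(|a_i|^{2n}|a_i^*|^{2n})+2^{2n-3}k^{4n-1}\left\|\sum_{i=1}^{k}(|a_i|^{4n}+|a_i^*|^{4n})\right\|+2^{2n-1}k^{8n-1}\left\|\sum_{i=1}^{k}|a_i|^{8n}\right\|.$$
   Context: $\mathfrak{A}$ is a complex, nonzero, unital $C^*$-algebra with unit $\boldsymbol{1}$; its state space $\mathfrak{S}(\mathfrak{A})$ is the set of all positive linear functionals $f\in\mathfrak{A}^*$ with $\|f\|=f(\boldsymbol{1})=1$. For $a\in\mathfrak{A}$: $|a|=(a^*a)^{1/2}$ and $|a^*|=(aa^* )^{1/2}$, with powers of positive elements given by the continuous functional calculus; the algebraic numerical radius is $w_{\mathfrak{A}}(a)=\sup\{|f(a)|:f\in\mathfrak{S}(\mathfrak{A})\}$; the algebraic Davis--Wielandt radius is $dw_{\mathfrak{A}}(a)=\sup\{\sqrt{|f(a)|^2+f(a^*a)^2}:f\in\mathfrak{S}(\mathfrak{A})\}$; $dw_{\mathfrak{A}}^{4n}(a)$ means $(dw_{\mathfrak{A}}(a))^{4n}$. *)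

(* Defs.v *)
From HB Require Import structures.
From mathcomp Require Import all_boot all_order all_algebra.
From mathcomp Require Import complex.
From mathcomp Require Import all_classical all_reals all_analysis.
Set Implicit Arguments.
Unset Strict Implicit.
Unset Printing Implicit Defensive.
Import Order.TTheory GRing.Theory Num.Theory.
Import numFieldNormedType.Exports.
Local Open Scope classical_set_scope.
Local Open Scope complex_scope.
Local Open Scope ring_scope.

(* Unital complex C*-algebras, with a real-valued norm.  [GRing.Algebra] is
   built on non-trivial rings, so it provides both the unit and [1 != 0].
   The norm is not a [Num.norm]: Hierarchy-Builder cannot join a ring with a
   norm valued in another ring, because in [numDomainType] a ring is already
   joined with a norm valued in itself. *)
HB.mixin Record isCStarAlgebra (R : realType) A & GRing.Algebra R[i] A := {
  cnorm : A -> R;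
  ler_cnormD : forall a b : A, cnorm (a + b) <= cnorm a + cnorm b;
  cnormZ : forall (z : R[i]) (a : A), cnorm (z *: a) = Normc.normc z * cnorm a;
  cnorm0_eq0 : forall a : A, cnorm a = 0 -> a = 0;
  ler_cnormM : forall a b : A, cnorm (a * b) <= cnorm a * cnorm b;
  cnorm_complete : forall u : nat -> A,
    (forall e : R, 0 < e -> exists N, forall p q,
       (N <= p)%N -> (N <= q)%N -> cnorm (u p - u q) < e) ->
    exists l : A, forall e : R, 0 < e -> exists N, forall p,
       (N <= p)%N -> cnorm (u p - l) < e;
  star : A -> A;
  starD : forall a b : A, star (a + b) = star a + star b;
  starZ : forall (z : R[i]) (a : A), star (z *: a) = conjc z *: star a;
  starM : forall a b : A, star (a * b) = star b * star a;
  starK : forall a : A, star (star a) = a;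
  cnorm_starM : forall a : A, cnorm (star a * a) = cnorm a ^+ 2
}.

#[short(type="cstarAlgType")]
HB.structure Definition CStarAlgebra (R : realType) :=
  {A of isCStarAlgebra R A & GRing.Algebra R[i] A}.

Section CStarAlgebraTheory.
Context {R : realType} {A : cstarAlgType R}.
Implicit Types (a b : A) (f : {linear A -> R[i]^o}) (g h : R[i]^o -> R[i]^o).

Definition invertible a := exists b, b * a = 1 /\ a * b = 1.

Definition spectrum a : set R[i]^o :=
  [set z : R[i]^o | ~ invertible (a - (z : R[i])%:A)].

Definition bounded_functional f :=
  exists M : R, forall a, Normc.normc (f a) <= M * cnorm a.

Definition dual_norm f : R :=
  sup [set Normc.normc (f a) | a in [set a | cnorm a <= 1]].

(* In the order of R[i], [0 <= z] means that z is real and nonnegative. *)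
Definition positive_functional f := forall a, 0 <= f (star a * a) :> R[i].

Definition states : set {linear A -> R[i]^o} :=
  [set f | [/\ bounded_functional f, positive_functional f,
               dual_norm f = 1 & f 1 = 1 :> R[i]]].

(* [Phi] is a unital *-homomorphism from C(spectrum a) to A sending the
   identity function to a.  An element of C(spectrum a) is represented by any
   total function whose restriction to the spectrum is continuous, hence the
   compatibility condition with equality on the spectrum. *)
Definition is_cfc a (Phi : (R[i]^o -> R[i]^o) -> A) :=
  let C := [set g | {within spectrum a, continuous g}] in
  (forall g h, C g -> C h -> {in spectrum a, g =1 h} -> Phi g = Phi h) /\
  (forall g h, C g -> C h -> Phi (fun z => g z + h z) = Phi g + Phi h) /\
  (forall (c : R[i]) g, C g -> Phi (fun z => c * g z) = c *: Phi g) /\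
  (forall g h, C g -> C h -> Phi (fun z => g z * h z) = Phi g * Phi h) /\
  (forall g, C g -> Phi (fun z => conjc (g z)) = star (Phi g)) /\
  Phi (fun=> 1) = 1 /\
  Phi id = a.

(* For a normal element a, [is_cfc a] determines its argument uniquely on the
   functions continuous on the spectrum. *)
Definition cfc a : (R[i]^o -> R[i]^o) -> A := xget (fun=> 0) (is_cfc a).

(* Real powers of a positive element, for positive exponents; its spectrum
   consists of nonnegative reals, where [complex.Re] is the identity. *)
Definition cpow a (r : R) : A := cfc a (fun z => ((complex.Re z) `^ r)%:C).

Definition cabs a : A := cpow (star a * a) 2^-1.

Definition numrad a : R := sup [set Normc.normc (f a) | f in states].

(* f (star a * a) is a nonnegative real for every state f. *)
Definition dwrad a : R :=
  sup [set Num.sqrt (Normc.normc (f a) ^+ 2 + complex.Re (f (star a * a)) ^+ 2)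
      | f in states].

End CStarAlgebraTheory.

(* Main.v *)
(** By convexity of powers the Davis-Wielandt quantity of a state f reduces to
    |f(S)|^(4n) and f(S* S)^(4n), where S is the sum of the a_i, and then to the
    same quantities for each a_i.  The mixed Schwarz inequality
    |f(a)|^2 <= f(|a|) f(|a* |), Jensen's inequality for f and Buzano's
    inequality bound the first, and Jensen's inequality alone the second.

    The continuous functional calculus of a self-adjoint element is obtained by
    uniform approximation by polynomials on the spectrum.  The isometry it
      needs,
    that a self-adjoint x has |x| or -|x| in its spectrum, is proved without
    complex analysis: square roots of 1 - b (|b| <= 1) come from an iteration,
    so x + i sqrt(1 - x^2) is unitary, which yields |1 - 2 x^2| <= 1 when
    |x| <= 1. *)

Require Import Defs.
From HB Require Import structures.
From mathcomp Require Import all_boot all_order all_algebra.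
From mathcomp Require Import complex.
From mathcomp Require Import all_classical all_reals all_analysis.
From mathcomp Require Import ring lra.
Set Implicit Arguments.
Unset Strict Implicit.
Unset Printing Implicit Defensive.
Import Order.TTheory GRing.Theory Num.Theory.
Import numFieldNormedType.Exports.
Local Open Scope classical_set_scope.
Local Open Scope complex_scope.
Local Open Scope ring_scope.

(** * Complex modulus and norm of a C*-algebra *)

(** The constants record the convexity steps. Splitting (|f(S)|^2 + f(S* S)^2)^(2n) costs 2^(2n-1);
    in the first part Buzano's inequality supplies a factor 1/2 and the arithmetic-geometric mean
    inequality another 1/2, whence 2^(2n-2) and 2^(2n-3). Passing from S to the k terms costs
    k^(4n-1) by the power mean inequality. For f(S* S) one first bounds S* S by k times the sum of
    the a_i* a_i, and the factor k raised to the power 4n turns k^(4n-1) into k^(8n-1). Most of the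
    work precedes these estimates. [cfc] is a choice among the maps that satisfy its laws, so
    nothing is known about powers until one such map is constructed. Moreover [cabs] takes a root of
    a* a, whose continuity on the spectrum is obtained from that spectrum being nonnegative. The
    axioms do not state this positivity, and its proof applies the calculus to the negative part of
    a* a; hence the calculus is set up for every self-adjoint element before any absolute value is
    used. *)

Section ComplexModulus.
Variable R : realType.
Implicit Types (z w : R[i]) (r s : R).
Import Normc.

Lemma normc_ge0 z : 0 <= normc z.
Proof. by case: z => x y; exact: sqrtr_ge0. Qed.

Lemma normcE z : (normc z)%:C = `|z|.
Proof. by []. Qed.

Lemma normc_real r : normc r%:C = `|r|.
Proof. by rewrite /= expr0n addr0 sqrtr_sqr. Qed.

Lemma normc_realB r s : normc (r%:C - s%:C) = `|r - s|.
Proof. by rewrite -(rmorphB (real_complex R)) normc_real. Qed.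

Lemma ler_normcD z w : normc (z + w) <= normc z + normc w.
Proof. by rewrite -lecR rmorphD /= !normcE ler_normD. Qed.

Lemma normcN z : normc (- z) = normc z.
Proof. by apply: complexI; rewrite !normcE normrN. Qed.

Lemma normcB z w : normc (z - w) = normc (w - z).
Proof. by rewrite -normcN opprB. Qed.

Lemma normc_conj z : normc (conjc z) = normc z.
Proof. by case: z => x y /=; rewrite sqrrN. Qed.

Lemma normc_sqr z : normc z ^+ 2 = complex.Re z ^+ 2 + complex.Im z ^+ 2.
Proof. by case: z => x y /=; rewrite sqr_sqrtr ?addr_ge0 ?sqr_ge0. Qed.

Lemma ler_normRe z : `|complex.Re z| <= normc z.
Proof.
by case: z => x y /=; rewrite -sqrtr_sqr ler_wsqrtr // lerDl sqr_ge0.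
Qed.

Lemma ler_normIm z : `|complex.Im z| <= normc z.
Proof.
by case: z => x y /=; rewrite -sqrtr_sqr ler_wsqrtr // lerDr sqr_ge0.
Qed.

Lemma ler_normc_ReIm z : normc z <= `|complex.Re z| + `|complex.Im z|.
Proof.
case: z => x y /=; rewrite -(@ler_pXn2r _ 2) ?nnegrE ?sqrtr_ge0 ?addr_ge0 //.
rewrite sqr_sqrtr ?addr_ge0 ?sqr_ge0 // sqrrD !real_normK ?num_real //.
by rewrite addrAC lerDl mulrn_wge0 // mulr_ge0.
Qed.

Lemma conjc_real r : conjc r%:C = r%:C.
Proof. by rewrite /conjc /= oppr0. Qed.

End ComplexModulus.

Lemma ReZ_real (R : realType) (r : R) (z : R[i]) :
  complex.Re (r%:C * z) = r * complex.Re z.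
Proof. by case: z => x y /=; rewrite mul0r subr0. Qed.

Lemma ReD (R : realType) (z w : R[i]) :
  complex.Re (z + w) = complex.Re z + complex.Re w.
Proof. by case: z w => [? ?] [? ?]. Qed.

Section Norm.
Variables (R : realType) (A : cstarAlgType R).
Implicit Types (a b c x y z : A) (r s t : R) (l : R[i]).
Import Normc.

Lemma cnorm0 : cnorm (0 : A) = 0.
Proof. by rewrite -(scale0r (0 : A)) cnormZ normc0 mul0r. Qed.

Lemma cnormN x : cnorm (- x) = cnorm x.
Proof. by rewrite -scaleN1r cnormZ normcN normc1 mul1r. Qed.

Lemma cnorm_ge0 x : 0 <= cnorm x.
Proof.
by have := ler_cnormD x (- x); rewrite subrr cnorm0 cnormN; lra.
Qed.

Lemma cnormB x y : cnorm (x - y) = cnorm (y - x).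
Proof. by rewrite -cnormN opprB. Qed.

Lemma ler_cnormB x y : cnorm (x - y) <= cnorm x + cnorm y.
Proof. by rewrite -(cnormN y) ler_cnormD. Qed.

Lemma ler_cnorm_dist x y : cnorm x <= cnorm y + cnorm (x - y).
Proof. by rewrite -{1}(subrKC y x) ler_cnormD. Qed.

Lemma cnormZr r x : 0 <= r -> cnorm (r%:C *: x) = r * cnorm x.
Proof. by move=> r0; rewrite cnormZ normc_real ger0_norm. Qed.

Lemma star0 : star (0 : A) = 0.
Proof. by apply: (addrI (star 0)); rewrite -starD !addr0. Qed.

Lemma starN x : star (- x) = - star x.
Proof.
by apply/eqP; rewrite -addr_eq0 -starD addNr star0.
Qed.

Lemma starB x y : star (x - y) = star x - star y.
Proof. by rewrite starD starN. Qed.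

Lemma starZr r x : star (r%:C *: x) = r%:C *: star x.
Proof. by rewrite starZ conjc_real. Qed.

Lemma star1 : star (1 : A) = 1.
Proof. by rewrite -[LHS]mul1r -[X in X * _]starK -starM mul1r starK. Qed.

Lemma star_sum (I : Type) (s : seq I) (P : pred I) (F : I -> A) :
  star (\sum_(i <- s | P i) F i) = \sum_(i <- s | P i) star (F i).
Proof. exact: (big_morph _ starD star0). Qed.

Lemma cnorm_star x : cnorm (star x) = cnorm x.
Proof.
suff H y : cnorm y <= cnorm (star y).
  by apply/eqP; rewrite eq_le H -{2}(starK x) H.
have [->|y0] := eqVneq (cnorm y) 0; first exact: cnorm_ge0.
have y1 : 0 < cnorm y by rewrite lt_def y0 cnorm_ge0.
by rewrite -(ler_pM2r y1) -expr2 -cnorm_starM ler_cnormM.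
Qed.

Lemma cnorm1 : cnorm (1 : A) = 1.
Proof.
have n0 : cnorm (1 : A) != 0.
  by apply/eqP => /cnorm0_eq0/eqP; rewrite oner_eq0.
by apply: (mulfI n0); rewrite mulr1 -expr2 -cnorm_starM star1 mul1r.
Qed.

Lemma cnorm_sa_sqr x : star x = x -> cnorm (x * x) = cnorm x ^+ 2.
Proof. by move=> sx; rewrite -cnorm_starM sx. Qed.

Lemma cnorm_sqr_le x r : 0 <= r -> cnorm (star x * x) <= r ^+ 2 -> cnorm x <= r.
Proof.
by move=> r0; rewrite cnorm_starM ler_pXn2r ?nnegrE ?cnorm_ge0.
Qed.

Lemma cnorm_eps_eq0 x : (forall e : R, 0 < e -> cnorm x <= e) -> x = 0.
Proof.
move=> H; apply: cnorm0_eq0; apply/eqP; rewrite eq_le cnorm_ge0 andbT.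
by apply/ler_addgt0Pl => e e0; rewrite addr0; exact: H.
Qed.

(** Spelled out with epsilons, in the shape of the axiom [cnorm_complete], because [cnorm] does not
    belong to the topological hierarchy. *)
Definition to_lim (u : nat -> A) x :=
  forall e : R, 0 < e -> exists N, forall p, (N <= p)%N -> cnorm (u p - x) < e.

Lemma to_lim_unique u x y : to_lim u x -> to_lim u y -> x = y.
Proof.
move=> ux uy; apply/subr0_eq/cnorm_eps_eq0 => e e0.
have e2 : 0 < e / 2 by lra.
have [N HN] := ux _ e2; have [M HM] := uy _ e2.
have := HN _ (leq_maxl N M); have := HM _ (leq_maxr N M).
set u0 := u _ => h1 h2; rewrite -(subrKA u0).
by have := ler_cnormD (x - u0) (u0 - y); rewrite (cnormB x); lra.
Qed.

Lemma to_lim_shift u x : to_lim u x -> to_lim (fun m => u m.+1) x.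
Proof.
by move=> ux e /ux[N HN]; exists N => p Np; apply: HN; exact: leqW.
Qed.

(** The majorant method: [t] is increasing and bounded, hence convergent, and its increments
    dominate those of [u]. It serves the Neumann series and the square root iteration. *)
Lemma cauchy_majorant u (t : nat -> R) M :
  (forall m, cnorm (u m.+1 - u m) <= t m.+1 - t m) -> (forall m, t m <= M) ->
  exists x, to_lim u x.
Proof.
move=> ut tM; apply: cnorm_complete => e e0.
have tnd : nondecreasing_seq t.
  apply/nondecreasing_seqP => m; rewrite -subr_ge0.
  by rewrite (le_trans _ (ut m)) ?cnorm_ge0.
have dist p m : cnorm (u (p + m)%N - u p) <= t (p + m)%N - t p.
  elim: m => [|m IH]; first by rewrite addn0 !subrr cnorm0.
  rewrite addnS -(subrKA (u (p + m)%N)) (le_trans (ler_cnormD _ _)) //.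
  by have := ut (p + m)%N; lra.
have tcvg : cvgn t.
  by apply: nondecreasing_is_cvgn => //; exists M => _ [m _ <-].
have e2 : 0 < e / 2 by lra.
have /cvgrPdist_lt/(_ _ e2)[N _ HN] := tcvg; exists N => p q Np Nq.
suff H m : (N <= m)%N -> cnorm (u m - u N) < e / 2.
  have h1 := H _ Np; have h2 := H _ Nq; rewrite -(subrKA (u N)).
  by have := ler_cnormD (u p - u N) (u N - u q); rewrite (cnormB (u N)); lra.
move=> Nm; rewrite -(subnKC Nm) (le_lt_trans (dist _ _)) //.
rewrite subnKC //.
have := HN _ Nm; have := HN N (leqnn N) => /=; rewrite !ltr_norml.
have := nondecreasing_cvgn_le tnd tcvg m.
by have := nondecreasing_cvgn_le tnd tcvg N; lra.
Qed.

End Norm.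

(** * Square roots and inverses by iteration *)

(* The iterates increase from 0 to 1 - sqrt (1 - b), the fixed point of
   [y |-> (b + y ^+ 2) / 2]; [h] stands for 1/2. *)
Fixpoint sqrt_iter (K : pzRingType) (h b : K) m : K :=
  if m is m'.+1 then h * (b + sqrt_iter h b m' * sqrt_iter h b m') else 0.

Section ScalarIteration.
Variable R : realType.
Local Notation t := (sqrt_iter (2^-1 : R) 1).

Lemma sqrt_iter1_ge0 m : 0 <= t m.
Proof. by case: m => //= m; have := sqr_ge0 (t m); rewrite expr2; lra. Qed.

Lemma sqrt_iter1_le1 m : t m <= 1.
Proof.
elim: m => //= m IH; have := sqrt_iter1_ge0 m; set s := t m in IH *.
by nra.
Qed.

(** At b = 1 the iterated map has slope 1 at its fixed point 1, so convergence is not geometric: the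
    gap d becomes d - d^2/2, which still decays like 2/m. *)
Lemma sqrt_iter1_dist m : 1 - t m <= 2 / (m.+2)%:R.
Proof.
elim: m => [|m IH /=]; first by rewrite subr0 divff.
have := sqrt_iter1_le1 m; have := sqrt_iter1_ge0 m.
set s := t m in IH *; move=> s0 s1.
set k : R := m.+2%:R in IH; have k2 : 2 <= k by rewrite ler_nat.
have -> : m.+3%:R = k + 1 :> R by rewrite -natr1.
have kV : 0 < k^-1 by rewrite invr_gt0; lra.
have kk : k * k^-1 = 1 by rewrite divff //; lra.
set v := k^-1 in IH kV kk.
rewrite ler_pdivlMr; last by lra.
(* The map d - d^2/2 increases on [0, 1], so the gap may be replaced by its bound 2 v. *)
have v1 : 2 * v <= 1 by nra.
have : 1 - 2^-1 * (1 + s * s) <= 2 * v - 2 * v * v by nra.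
have -> : 2 * v - 2 * v * v = 2 * v * (1 - v) by ring.
move=> h; have : (1 - 2^-1 * (1 + s * s)) * (k + 1) <= 2 * v * (1 - v) * (k +
  1).
  by rewrite ler_pM2r //; lra.
move/le_trans; apply.
have -> : 2 * v * (1 - v) * (k + 1) = 2 * (1 - v) * (k * v + v) by ring.
by rewrite kk; nra.
Qed.

(* The error is largest at v = 0. *)
Lemma sqrt_iter_error (v : R) m : 0 <= v <= 1 ->
  `|1 - Num.sqrt v - sqrt_iter 2^-1 (1 - v) m| <= 1 - t m.
Proof.
case/andP=> v0 v1; have := sqr_sqrtr v0; have := sqrtr_ge0 v.
set q := Num.sqrt v => q0; rewrite expr2 => qq.
have q1 : q <= 1 by nra.
elim: m => [|m IH] /=; first by rewrite ger0_norm; lra.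
set s := sqrt_iter _ (1 - v) m in IH *; have := sqrt_iter1_ge0 m.
have := sqrt_iter1_le1 m; set r := t m in IH * => r1 r0.
(* Both errors are half a difference of squares, relative to the fixed points 1 - q and 1; the
   factors are then compared one by one. *)
have -> : 1 - q - 2^-1 * (1 - v + s * s) = 2^-1 * (1 - q + s) * (1 - q - s).
  by rewrite -qq; field.
have -> : 1 - 2^-1 * (1 + r * r) = 2^-1 * (1 + r) * (1 - r) by field.
rewrite normrM ler_pM //.
suff : `|s| <= r by rewrite !ler_norml => /andP[? ?]; lra.
have : forall m', `|sqrt_iter 2^-1 (1 - v) m'| <= t m'.
  elim=> [|k] /=; first by rewrite normr0.
  set x := sqrt_iter _ (1 - v) k; set y := t k.
  rewrite !ler_norml => /andP[? ?]; apply/andP; split; nra.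
exact.
Qed.

End ScalarIteration.

Section Limits.
Variables (R : realType) (A : cstarAlgType R).
Implicit Types (a b c x y z : A) (r s t : R) (l : R[i]) (u v : nat -> A).

Lemma to_lim_cst x : to_lim (fun=> x) x.
Proof. by move=> e e0; exists 0%N => p _; rewrite subrr cnorm0. Qed.

Lemma to_limD u v x y :
  to_lim u x -> to_lim v y -> to_lim (fun m => u m + v m) (x + y).
Proof.
move=> ux vy e e0; have e2 : 0 < e / 2 by lra.
have [N HN] := ux _ e2; have [M HM] := vy _ e2; exists (maxn N M) => p.
rewrite geq_max => /andP[/HN h1 /HM h2]; rewrite opprD addrACA.
by have := ler_cnormD (u p - x) (v p - y); lra.
Qed.

Lemma to_limM u v x y :
  to_lim u x -> to_lim v y -> to_lim (fun m => u m * v m) (x * y).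
Proof.
move=> ux vy e e0; set K := cnorm x + cnorm y + 1.
have K1 : 1 <= K by have := cnorm_ge0 x; have := cnorm_ge0 y; rewrite /K; lra.
pose d := Num.min 1 (e / (2 * K)).
have d0 : 0 < d by rewrite lt_min ltr01 divr_gt0 //; lra.
have d1 : d <= 1 by rewrite ge_min lexx.
have dK : 2 * K * d <= e.
  rewrite -[leRHS](@mulfVK _ (2 * K)); last by apply/eqP; lra.
  by rewrite [leRHS]mulrC ler_pM2l ?ge_min ?lexx ?orbT //; lra.
have [N HN] := ux _ d0; have [M HM] := vy _ d0; exists (maxn N M) => p.
rewrite geq_max => /andP[/HN h1 /HM h2].
have -> : u p * v p - x * y = (u p - x) * v p + x * (v p - y).
  by rewrite mulrBl mulrBr subrKA.
have h3 := ler_cnorm_dist (v p) y.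
have := ler_cnormD ((u p - x) * v p) (x * (v p - y)).
have := ler_cnormM (u p - x) (v p); have := ler_cnormM x (v p - y).
have := cnorm_ge0 x; have := cnorm_ge0 y; have := cnorm_ge0 (u p - x).
have := cnorm_ge0 (v p); have := cnorm_ge0 (v p - y).
rewrite /K in dK; set A1 := cnorm (u p - x) in h1 *;
  set A2 := cnorm (v p) in h3 *.
set A3 := cnorm (v p - y) in h2 h3 *; set X := cnorm x in dK *.
set Y := cnorm y in dK h3 *.
move=> p3 p2 p1 pY pX m2 m1 tr.
have : A1 * A2 <= d * (Y + 1) by rewrite ler_pM //; lra.
have : X * A3 <= X * d by rewrite ler_wpM2l //; lra.
by nra.
Qed.

Lemma to_lim_star u x : to_lim u x -> to_lim (fun m => star (u m)) (star x).
Proof.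
move=> ux e /ux[N HN]; exists N => p /HN; by rewrite -starB cnorm_star.
Qed.

Lemma scale_half_twice x : (2^-1 : R)%:C *: x + (2^-1 : R)%:C *: x = x.
Proof.
by rewrite -scalerDl -rmorphD /= (_ : 2^-1 + 2^-1 = 1) ?scale1r //; field.
Qed.

(** The partial sums of the Neumann series satisfy u' = 1 + b u and also u' = 1 + u b; the limit
    inherits both equations, one for each side of the inverse. *)
Lemma invertible_subr1 b : cnorm b < 1 -> invertible (1 - b).
Proof.
move=> b1; have b0 := cnorm_ge0 b;
  pose u := fix u m := if m is m'.+1 then 1 + b * u m' else 0.
have u1 m : u m.+1 = 1 + b * u m by [].
have uS m : u m.+1 = 1 + u m * b.
  elim: m => [|m IH]; first by rewrite /= mulr0 mul0r.
  by rewrite u1 {1}IH u1 mulrDr mulr1 mulrDl mul1r mulrA.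
have du m : cnorm (u m.+1 - u m) <= cnorm b ^+ m.
  elim: m => [|m IH]; first by rewrite /= mulr0 addr0 subr0 cnorm1 expr0.
  rewrite /= -/(u m.+1) opprD addrACA subrr add0r -mulrBr exprS.
  by rewrite (le_trans (ler_cnormM _ _)) // ler_wpM2l.
pose t m := (1 - cnorm b ^+ m) / (1 - cnorm b).
have [|m|x ux] := @cauchy_majorant _ _ u t (1 - cnorm b)^-1.
- move=> m; rewrite (le_trans (du m)) // /t -mulrBl exprS.
  by rewrite le_eqVlt; apply/orP; left; apply/eqP; field; lra.
- rewrite /t ler_piMl // ?invr_ge0; first by lra.
  by have := exprn_ge0 m b0; lra.
have e1 : x = 1 + b * x.
  apply: to_lim_unique (to_lim_shift ux) _.
  exact: to_limD (to_lim_cst 1) (to_limM (to_lim_cst b) ux).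
have e2 : x = 1 + x * b.
  apply: to_lim_unique (to_lim_shift ux) _.
  have -> : (fun m => u m.+1) = (fun m => 1 + u m * b) by apply/funext.
  exact: to_limD (to_lim_cst 1) (to_limM ux (to_lim_cst b)).
exists x; split; first by rewrite mulrBr mulr1 {1}e2 addrK.
by rewrite mulrBl mul1r {1}e1 addrK.
Qed.

(** The increments are dominated by those of the scalar iteration at 1, which covers the boundary
    case of norm 1. Self-adjointness and commutation hold for the iterates and pass to the limit y;
    the root is 1 - y. *)
Lemma sqrt_one_minus b : cnorm b <= 1 ->
  exists d, [/\ d * d = 1 - b, star b = b -> star d = d &
    forall z, z * b = b * z -> z * d = d * z].
Proof.
move=> b1; pose h : A := ((2^-1 : R)%:C)%:A.
have [u [u0 uS]] : exists u : nat -> A,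
  u 0%N = 0 /\ forall m, u m.+1 = h * (b + u m * u m) by exists (sqrt_iter h b).
have hC z : h * z = z * h by rewrite mulr_algl mulr_algr.
have uC z m : z * b = b * z -> z * u m = u m * z.
  move=> zb; elim: m => [|m IH]; first by rewrite u0 mulr0 mul0r.
  rewrite uS mulrA -hC -!mulrA mulrDr mulrDl zb; congr (h * (_ + _)).
  by rewrite mulrA IH -[LHS]mulrA IH mulrA.
have uN m : cnorm (u m) <= sqrt_iter (2^-1 : R) 1 m.
  elim: m => [|m IH] /=; first by rewrite u0 cnorm0.
  rewrite uS mulr_algl cnormZr ?invr_ge0 // ler_pM2l ?invr_gt0 //.
  rewrite (le_trans (ler_cnormD _ _)) // lerD // (le_trans (ler_cnormM _ _)) //.
  by rewrite ler_pM ?cnorm_ge0.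
have [||y uy] := @cauchy_majorant _ _ u (sqrt_iter (2^-1 : R) 1) 1.
- elim=> [|m IH].
    rewrite uS u0 /= !mulr0 !addr0 !subr0 mulr_algl cnormZr ?invr_ge0 //.
    by rewrite ler_pM2l ?invr_gt0.
  set t := sqrt_iter (2^-1 : R) 1 in IH uN *.
  have -> : u m.+2 - u m.+1 = h * ((u m.+1 + u m) * (u m.+1 - u m)).
    rewrite (uS m.+1) [in X in _ - X]uS -mulrBr; congr (h * _).
    rewrite opprD addrACA subrr add0r mulrBr !mulrDl opprD.
    rewrite (uC (u m) m.+1) ?addrA ?addrK //.
    by rewrite -uC.
  have -> : t m.+2 - t m.+1 = 2^-1 * ((t m.+1 + t m) * (t m.+1 - t m)).
    have tS k : t k.+1 = 2^-1 * (1 + t k * t k) by [].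
    by rewrite (tS m.+1) [in X in _ - X]tS; ring.
  rewrite mulr_algl cnormZr ?invr_ge0 // ler_pM2l ?invr_gt0 //.
  rewrite (le_trans (ler_cnormM _ _)) // ler_pM ?cnorm_ge0 //.
  by rewrite (le_trans (ler_cnormD _ _)) // lerD.
- by move=> m; exact: sqrt_iter1_le1.
have ey : y = h * (b + y * y).
  apply: to_lim_unique (to_lim_shift uy) _.
  rewrite (_ : (fun m => u m.+1) = (fun m => h * (b + u m * u m)));
    last exact/funext.
  exact: to_limM (to_lim_cst h) (to_limD (to_lim_cst b) (to_limM uy uy)).
have y2 : y + y = b + y * y.
  by rewrite {1 2}ey mulr_algl scale_half_twice.
exists (1 - y); split.
- have -> : b = y + y - y * y by rewrite y2 addrK.
  by rewrite mulrBr mulr1 mulrBl mul1r !opprB -addrA opprD (addrCA (- y)).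
- move=> sb; rewrite starB star1; congr (1 - _).
  apply: to_lim_unique (to_lim_star uy) _.
  suff -> : (fun m => star (u m)) = u by [].
  apply/funext; elim=> [|m IH]; first by rewrite u0 star0.
  by rewrite uS starM starD starM IH sb hC /h starZr star1.
- move=> z zb; rewrite mulrBr mulrBl mulr1 mul1r; congr (_ - _).
  apply: to_lim_unique (to_limM (to_lim_cst z) uy) _.
  have -> : (fun m => z * u m) = (fun m => u m * z).
    by apply/funext => m; exact: uC.
  exact: to_limM uy (to_lim_cst z).
Qed.

End Limits.

(** * The norm of a self-adjoint element *)

Section Invertible.
Variables (R : realType) (A : cstarAlgType R).
Implicit Types (a b c x y z : A) (l : R[i]).

Lemma invertibleM a b : invertible a -> invertible b -> invertible (a * b).
Proof.
case=> [a' [a1 a2]] [b' [b1 b2]]; exists (b' * a').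
by rewrite mulrA -(mulrA b') a1 mulr1 b1 mulrA -(mulrA a) b2 mulr1 a2.
Qed.

Lemma inverse_comm a b z : b * a = 1 -> a * b = 1 -> z * a = a * z ->
  z * b = b * z.
Proof.
by move=> ba ab za; rewrite -[LHS]mul1r -ba -mulrA (mulrA a) -za -mulrA ab
  mulr1.
Qed.

Lemma invertible_commMl a b :
  a * b = b * a -> invertible (a * b) -> invertible a.
Proof.
move=> ab [c [c1 c2]]; exists (c * b); split; first by rewrite -mulrA -ab.
have bc : b * c = c * b by apply: (inverse_comm c1 c2); rewrite mulrA -ab.
by rewrite -bc mulrA c2.
Qed.

Lemma invertibleZ l a : l != 0 -> invertible a -> invertible (l *: a).
Proof.
move=> l0 [b [b1 b2]]; exists (l^-1 *: b).
by rewrite -!scalerAl -!scalerAr !scalerA b1 b2 mulVf // mulfV // scale1r.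
Qed.

Lemma invertibleN a : invertible (- a) -> invertible a.
Proof.
by move=> [b [b1 b2]]; exists (- b); rewrite mulNr -mulrN b1 mulrN -mulNr.
Qed.

Lemma not_invertible0 : ~ invertible (0 : A).
Proof. by case=> b [_ /eqP]; rewrite mul0r eq_sym oner_eq0. Qed.

Lemma inverse_star a b : b * a = 1 -> a * b = 1 -> star a = a -> star b = b.
Proof.
move=> ba ab sa; rewrite -[LHS]mulr1 -ab mulrA -{1}sa -starM ab star1 mul1r //.
Qed.

End Invertible.

Section SelfAdjointNorm.
Variables (R : realType) (A : cstarAlgType R).
Implicit Types (a b c x y z : A) (r s t : R) (l : R[i]).
Import Normc.

Lemma cnorm_twice x : cnorm (x + x) = 2 * cnorm x.
Proof.
rewrite -(cnormZr x (ler0n R 2)); congr cnorm.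
by rewrite rmorph_nat scaler_nat mulr2n.
Qed.

Lemma cnorm_real r : cnorm (r%:C%:A : A) = `|r|.
Proof. by rewrite cnormZ normc_real cnorm1 mulr1. Qed.

Lemma sqrrD_noncomm x y :
  (x + y) * (x + y) = (x * x + y * y) + (x * y + y * x).
Proof. by rewrite mulrDl !mulrDr (addrC (y * x)) addrACA. Qed.

(** A double angle formula: if x is read as cos t, then [x + e] is exp(it), and 2 x^2 - 1 = cos 2t
    is the mean of the squares of [x + e] and of its adjoint [x - e]. *)
Lemma sa_sqr_le1 x : star x = x -> cnorm x <= 1 ->
  cnorm (1 - (x * x + x * x)) <= 1.
Proof.
move=> sx x1; have b1 : cnorm (x * x) <= 1.
  by rewrite cnorm_sa_sqr // exprn_ile1 ?cnorm_ge0.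
have [d [dd sd dC]] := sqrt_one_minus b1.
have {}sd : star d = d by apply: sd; rewrite starM sx.
have xd : x * d = d * x by apply: dC; rewrite mulrA.
pose e : A := 'i *: d.
have ee : e * e = - (d * d).
  by rewrite -scalerAl -scalerAr scalerA -expr2 sqr_i scaleN1r.
have se : star e = - e.
  rewrite starZ sd -scaleNr; congr (_ *: _).
  by apply/eqP; rewrite eq_complex /= oppr0 !eqxx.
have xe : x * e = e * x by rewrite -scalerAr xd scalerAl.
have su : star (x + e) = x - e by rewrite starD sx se.
have u1 : cnorm (x + e) = 1.
  have : cnorm (x + e) ^+ 2 = 1.
    rewrite -cnorm_starM su mulrDr !mulrBl ee xe addrA subrK opprK dd.
    by rewrite subrKC cnorm1.
  by move/eqP; rewrite sqrf_eq1 => /orP[]/eqP //; have := cnorm_ge0 (x + e);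
    lra.
have v1 : cnorm (x - e) = 1 by rewrite -su cnorm_star.
have -> : 1 - (x * x + x * x) = - (x * x + e * e).
  by rewrite ee dd opprB opprD addrA.
rewrite cnormN; have w2 := cnorm_twice (x * x + e * e).
have : cnorm ((x + e) * (x + e) + (x - e) * (x - e)) <= 2.
  rewrite (le_trans (ler_cnormD _ _)) //.
  have := ler_cnormM (x + e) (x + e); have := ler_cnormM (x - e) (x - e).
  by rewrite u1 v1; lra.
have -> : (x + e) * (x + e) + (x - e) * (x - e) =
          (x * x + e * e) + (x * x + e * e).
  rewrite !sqrrD_noncomm !mulrN !mulNr xe opprK.
  by rewrite addrACA -opprD subrr addr0.
by rewrite w2; lra.
Qed.

Lemma sa_sqr_le x s : star x = x -> 0 < s -> cnorm (x * x) <= s ->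
  cnorm (s%:C%:A - (x * x + x * x)) <= s.
Proof.
move=> sx s0 xs; have q0 : 0 < Num.sqrt s by rewrite sqrtr_gt0.
pose y := ((Num.sqrt s)^-1)%:C *: x.
have yy : y * y = (s^-1)%:C *: (x * x).
  rewrite -scalerAl -scalerAr scalerA -rmorphM /= -invfM -expr2.
  by rewrite sqr_sqrtr // ltW.
have sy : star y = y by rewrite starZr sx.
have : cnorm y <= 1.
  apply: cnorm_sqr_le => //; rewrite sy yy cnormZr ?invr_ge0 ?(ltW s0) //.
  by rewrite expr1n mulrC ler_pdivrMr // mul1r.
move/(sa_sqr_le1 sy); rewrite -(ler_pM2l s0) mulr1 -cnormZr ?(ltW s0) //.
rewrite yy -scalerDr scalerBr scalerA -rmorphM /= divff ?lt0r_neq0 //.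
by rewrite scale1r.
Qed.

(* If [1 - x ^+ 2] had an inverse [y], then [1 - x ^+ 2 - 1/M] would be the
   square of a self-adjoint element for M large, forcing |x| < 1. *)
Lemma sa_norm1_spectral x :
  star x = x -> cnorm x = 1 -> ~ invertible (1 - x * x).
Proof.
move=> sx x1 [y [yc cy]]; set c := 1 - x * x in yc cy.
have sc : star c = c by rewrite starB starM sx star1.
have sy := inverse_star yc cy sc.
have b1 : cnorm (x * x) <= 1 by rewrite cnorm_sa_sqr // x1 expr1n.
have [d [dd sd _]] := sqrt_one_minus b1; rewrite -/c in dd.
have {}sd : star d = d by apply: sd; rewrite starM sx.
have dy : d * y = y * d by apply: (inverse_comm yc cy); rewrite -dd mulrA.
(* M dominates the norm of y, so that 1 - y/M has a square root, and M >= 2 makes 2 r - 1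
   nonnegative for r = 1 - 1/M. *)
pose M := 2 + cnorm y; have M2 : 2 <= M by have := cnorm_ge0 y; rewrite /M; lra.
have M0 : 0 < M by lra.
have MV : M^-1 <= 2^-1 by rewrite lef_pV2 ?posrE //; lra.
have MV0 : 0 < M^-1 by rewrite invr_gt0.
pose y' := (M^-1)%:C *: y.
have y'1 : cnorm y' <= 1.
  by rewrite cnormZr ?(ltW MV0) // mulrC ler_pdivrMr // mul1r /M; lra.
have [e [ee se eC]] := sqrt_one_minus y'1.
have {}se : star e = e by apply: se; rewrite starZr sy.
have de : d * e = e * d by apply: eC; rewrite -scalerAr dy -scalerAl.
pose v := d * e; have sv : star v = v by rewrite starM sd se -de.
pose r := 1 - M^-1.
have vv : v * v = r%:C%:A - x * x.
  rewrite /v {2}de mulrA -(mulrA d) ee mulrBr mulr1 mulrBl dd.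
  rewrite -scalerAr -scalerAl -mulrA -dy mulrA dd cy /c /r.
  by rewrite rmorphB /= scalerBl scale1r addrAC.
(* Here 2 v^2 = (2 r - 1) + (1 - 2 x^2), and the last term has norm at most 1. *)
have vr : cnorm (v * v) <= r.
  have x1' : cnorm x <= 1 by rewrite x1.
  have h := sa_sqr_le1 sx x1'; have := cnorm_twice (v * v).
  have -> : v * v + v * v = (2 * r - 1)%:C%:A + (1 - (x * x + x * x)).
    rewrite vv addrACA -opprD -scalerDl -rmorphD /= [RHS]addrA; congr (_ - _).
    rewrite -[X in _ = _ + X]scale1r -scalerDl; congr (_ *: _).
    by rewrite -(rmorph1 (real_complex R)) -rmorphD /=; congr _%:C; ring.
  have := ler_cnormD ((2 * r - 1)%:C%:A : A) (1 - (x * x + x * x)).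
  by rewrite cnorm_real ger0_norm /r; lra.
have r0 : 0 < r by rewrite /r; lra.
(* Since r - 2 v^2 = 2 x^2 - r, this yields 2 = |2 x^2| <= 2 r < 2. *)
have := sa_sqr_le sv r0 vr.
have -> : r%:C%:A - (v * v + v * v) = (x * x + x * x) - r%:C%:A.
  rewrite vv addrACA -opprD opprB addrCA; congr (_ + _).
  by rewrite opprD addrA subrr sub0r.
move=> h; have := ler_cnorm_dist (x * x + x * x) (r%:C%:A).
have r1 : r < 1 by rewrite /r; lra.
by rewrite cnorm_real gtr0_norm // cnorm_twice cnorm_sa_sqr // x1 expr1n; lra.
Qed.

Lemma sa_norm_spectral x : star x = x -> 0 < cnorm x ->
  ~ invertible ((cnorm x ^+ 2)%:C%:A - x * x).
Proof.
move=> sx x0 xi; pose N := cnorm x.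
have N2 : N ^+ 2 != 0 by rewrite expf_neq0 // lt0r_neq0.
have y1 : cnorm ((N^-1)%:C *: x) = 1.
  by rewrite cnormZr ?invr_ge0 ?ltW // mulVf // lt0r_neq0.
apply: (sa_norm1_spectral _ y1); first by rewrite starZr sx.
rewrite -scalerAl -scalerAr scalerA -rmorphM /= -invfM -expr2.
have -> : 1 - (N ^- 2)%:C *: (x * x) =
          (N ^- 2)%:C *: ((N ^+ 2)%:C%:A - x * x).
  by rewrite scalerBr scalerA -rmorphM /= mulVf // scale1r.
by apply: invertibleZ => //;
  rewrite -(rmorph0 (real_complex R)) (inj_eq (@complexI R)) invr_neq0.
Qed.

End SelfAdjointNorm.

(** * Spectrum and polynomials *)

Section Spectrum.
Variables (R : realType) (A : cstarAlgType R).
Implicit Types (a b c x y z : A) (r s t : R) (l w : R[i]) (p q : {poly R[i]}).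
Import Normc.

Lemma spectrum_normc a l : spectrum a l -> normc l <= cnorm a.
Proof.
move=> al; rewrite leNgt; apply/negP => an; apply: al.
have l0 : normc l != 0 by rewrite gt_eqF // (le_lt_trans (cnorm_ge0 a)).
have {}l0 : l != 0 by apply: contraNneq l0 => ->; rewrite normc0.
apply: invertibleN; rewrite opprB.
have -> : l%:A - a = l *: (1 - l^-1 *: a).
  by rewrite scalerBr scalerA divff // scale1r.
apply: invertibleZ => //; apply: invertible_subr1.
have nl : 0 < normc l by rewrite (le_lt_trans (cnorm_ge0 a)).
by rewrite cnormZ normcV mulrC ltr_pdivrMr // mul1r.
Qed.

(** Shifting by i t adds at most t^2 to the squared norm of a, while the squared modulus of the
    shifted spectral value grows by t^2 + 2 v t, where v is the imaginary part; [t] is chosen so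
    that 2 v t is too large. *)
Lemma spectrum_sa_real a l : star a = a -> spectrum a l -> complex.Im l = 0.
Proof.
move=> sa; case: l => u v al /=; apply: contrapT => /eqP v0.
pose t := (cnorm a ^+ 2 + 1) / v; pose x := a + (0 +i* t)%C%:A.
have : spectrum x (u +i* (v + t))%C.
  move=> xi; apply: al.
  have -> // : a - (u +i* v)%C%:A = x - (u +i* (v + t))%C%:A.
  have -> : (u +i* (v + t))%C = (u +i* v)%C + (0 +i* t)%C.
    by apply/eqP; rewrite eq_complex /= addr0 !eqxx.
  by rewrite scalerDl /x opprD addrACA subrr addr0.
move/spectrum_normc.
rewrite -(@ler_pXn2r _ 2) ?nnegrE ?cnorm_ge0 ?normc_ge0 // normc_sqr /=.
have : cnorm x ^+ 2 <= cnorm a ^+ 2 + t ^+ 2.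
  rewrite -cnorm_starM; have -> : star x = a - (0 +i* t)%C%:A.
    rewrite starD sa starZ star1 -scaleNr; congr (_ + _ *: _).
    by apply/eqP; rewrite eq_complex /= oppr0 !eqxx.
  have -> : (a - (0 +i* t)%C%:A) * x = a * a + (t ^+ 2)%:C%:A.
    rewrite mulrDr !mulrBl mulr_algl mulr_algr addrA subrK; congr (_ + _).
    rewrite mulr_algl scalerA -scaleNr; congr (_ *: _).
    by apply/eqP; rewrite eq_complex /=; apply/andP; split; apply/eqP; ring.
  rewrite (le_trans (ler_cnormD _ _)) // cnorm_sa_sqr // cnorm_real.
  by rewrite ger0_norm ?sqr_ge0.
have vt : v * t = cnorm a ^+ 2 + 1 by rewrite /t mulrC divfK.
have := sqr_ge0 u; have := sqr_ge0 v; have := sqr_ge0 (cnorm a); nra.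
Qed.

Lemma spectrum_closed a l :
  (forall e : R, 0 < e -> exists2 w, spectrum a w & normc (w - l) < e) ->
  spectrum a l.
Proof.
move=> H [b [b1 b2]]; have b0 := cnorm_ge0 b.
have [|w aw wl] := H (cnorm b + 1)^-1; first by rewrite invr_gt0; lra.
apply: aw.
have -> : a - w%:A = (a - l%:A) * (1 - (w - l) *: b).
  rewrite mulrBr mulr1 -scalerAr b2 scalerBl opprB addrA.
  by rewrite subrK.
apply: invertibleM; first by exists b.
apply: invertible_subr1; rewrite cnormZ.
have : normc (w - l) * (cnorm b + 1) < 1 by rewrite -ltr_pdivlMr ?mul1r //; lra.
by have := normc_ge0 (w - l); nra.
Qed.

(** Otherwise both factors of a^2 - |a|^2 would be invertible, and so would their product. This
    replaces the spectral radius formula and shows that the spectrum is nonempty. *)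
Lemma sa_norm_in_spectrum a : star a = a ->
  spectrum a (cnorm a)%:C \/ spectrum a (- cnorm a)%:C.
Proof.
move=> sa; have [a0|a0] := eqVneq (cnorm a) 0.
  left; rewrite a0 (cnorm0_eq0 _ a0) /spectrum /= rmorph0 scale0r subrr.
  exact: not_invertible0.
apply: contrapT => /not_orP[/contrapT i1 /contrapT i2].
apply: (sa_norm_spectral sa); first by rewrite lt_def a0 cnorm_ge0.
have -> : (cnorm a ^+ 2)%:C%:A - a * a =
  - ((a - (cnorm a)%:C%:A) * (a - (- cnorm a)%:C%:A)).
  rewrite rmorphN /= scaleNr opprK mulrDr !mulrBl mulr_algl mulr_algr addrA.
  rewrite subrK mulr_algl scalerA -rmorphM /= -expr2 opprB.
  by [].
by apply: invertibleN; rewrite opprK; exact: invertibleM.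
Qed.

(** [R[i]] is algebraically closed, so p splits; its roots lie outside the spectrum, where the
    linear factors are invertible. *)
Lemma horner_alg_invertible a p : p != 0 ->
  (forall l, spectrum a l -> p.[l] != 0) -> invertible (horner_alg a p).
Proof.
move=> p0 H; have [rs ers] := closed_field_poly_normal p.
have {}H l : l \in rs -> invertible (a - l%:A).
  move=> lrs; apply: contrapT => /H; rewrite ers hornerZ horner_prod.
  by rewrite (big_rem l) //= hornerXsubC subrr mul0r mulr0 eqxx.
rewrite ers linearZ /= rmorph_prod mulr_algl; apply: invertibleZ.
  by rewrite lead_coef_eq0.
elim: {p p0 ers} rs H => [|l rs IH] H.
  by rewrite big_nil; exists 1; rewrite mulr1.
rewrite big_cons; apply: invertibleM.
  by rewrite rmorphB /= horner_algX horner_algC; apply: H; rewrite mem_head.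
by apply: IH => w ww; apply: H; rewrite in_cons ww orbT.
Qed.

Lemma spectrum_horner a p w : star a = a -> spectrum (horner_alg a p) w ->
  exists2 l, spectrum a l & p.[l] = w.
Proof.
move=> sa pw; apply: contrapT => H; apply: pw.
have H' l : spectrum a l -> (p - w%:P).[l] != 0.
  by move=> al; rewrite !hornerE subr_eq0; apply/eqP => e; apply: H; exists l.
have -> : horner_alg a p - w%:A = horner_alg a (p - w%:P).
  by rewrite rmorphB /= horner_algC.
apply: horner_alg_invertible => //; apply/eqP => p0.
(* If p is the constant w, any point of the spectrum is a preimage, and the spectrum is nonempty. *)
by case: (sa_norm_in_spectrum sa) => /H'; rewrite p0 horner0 eqxx.
Qed.

Lemma star_horner_alg a p : star a = a ->
  star (horner_alg a p) = horner_alg a (map_poly conjc p).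
Proof.
move=> sa; elim/poly_ind: p => [|p c IH]; first by rewrite !rmorph0 star0.
have -> : map_poly conjc (p * 'X + c%:P) = map_poly conjc p * 'X + (conjc c)%:P.
  by rewrite rmorphD rmorphM /= map_polyX map_polyC.
rewrite !rmorphD !rmorphM /= !horner_algX !horner_algC starD starM IH sa starZ.
rewrite star1; congr (_ + _).
elim/poly_ind: (map_poly _ p) => [|q d IHq];
  first by rewrite rmorph0 mulr0 mul0r.
rewrite rmorphD rmorphM /= horner_algX horner_algC mulrDl mulrDr mulrA IHq.
by rewrite mulr_algl mulr_algr.
Qed.

(** The value of p at a need not be self-adjoint, but by the C*-identity its squared norm is the
    norm of q(a), with q the product of p and its conjugate. That norm is, up to sign, a value of q
    on the real spectrum. *)
Lemma cnorm_horner_alg_le a p s : star a = a -> 0 <= s ->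
  (forall l, spectrum a l -> normc p.[l] <= s) -> cnorm (horner_alg a p) <= s.
Proof.
move=> sa s0 H; apply: cnorm_sqr_le => //.
rewrite star_horner_alg // -rmorphM /=; set q := map_poly _ p * p.
have sq : star (horner_alg a q) = horner_alg a q.
  by rewrite rmorphM /= starM -star_horner_alg // starK.
have qs l : spectrum a l -> normc q.[l] <= s ^+ 2.
  move=> al; rewrite hornerM normcM -{1}(_ : conjc l = l).
    by rewrite horner_map /= normc_conj -expr2 ler_pXn2r ?nnegrE ?normc_ge0 ?H.
  have := spectrum_sa_real sa al; case: (l) => u v /= ->.
  by rewrite /conjc oppr0.
by case: (sa_norm_in_spectrum sq) => /(spectrum_horner sa)[l /qs + e];
  rewrite e normc_real ?normrN ger0_norm ?cnorm_ge0.
Qed.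

End Spectrum.

(** * The Weierstrass approximation theorem *)

Section Weierstrass.
Variable R : realType.
Implicit Types (X : set R) (u v g : R -> R) (s t e : R).

Definition eps_continuous X g := forall x, X x -> forall e : R, 0 < e ->
  exists2 d, 0 < d & forall y, X y -> `|y - x| < d -> `|g y - g x| < e.

Definition poly_approx X u := forall e : R, 0 < e ->
  exists p : {poly R}, forall t, X t -> `|p.[t] - u t| <= e.

(** The reason why the iteration is defined over any ring: run on polynomials, it produces
    polynomial approximations of a square root. *)
Lemma horner_sqrt_iter h (p : {poly R}) m t :
  (sqrt_iter h%:P p m).[t] = sqrt_iter h p.[t] m.
Proof. by elim: m => [|m IH] /=; rewrite ?horner0 // !hornerE IH. Qed.

Lemma poly_approx_horner X (p : {poly R}) : poly_approx X (fun t => p.[t]).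
Proof. by move=> e e0; exists p => t _; rewrite subrr normr0 ltW. Qed.

Lemma poly_approxD X u v :
  poly_approx X u -> poly_approx X v -> poly_approx X (fun t => u t + v t).
Proof.
move=> Hu Hv e e0; have e2 : 0 < e / 2 by lra.
have [p Hp] := Hu _ e2; have [q Hq] := Hv _ e2; exists (p + q) => t Xt.
rewrite hornerD opprD addrACA.
by have := ler_normD (p.[t] - u t) (q.[t] - v t); have := Hp _ Xt;
  have := Hq _ Xt; lra.
Qed.

Lemma poly_approxZ X u s : poly_approx X u -> poly_approx X (fun t => s * u t).
Proof.
move=> Hu e e0; have s1 : 0 < `|s| + 1 by have := normr_ge0 s; lra.
have [|p Hp] := Hu (e / (`|s| + 1)); first exact: divr_gt0.
exists (s *: p) => t Xt; rewrite hornerZ -mulrBr normrM.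
have := Hp _ Xt; rewrite ler_pdivlMr //.
by have := normr_ge0 s; have := normr_ge0 (p.[t] - u t); nra.
Qed.

(** One has |q| = C sqrt((q/C)^2), and on [0, 1] the iterates at 1 - v approximate 1 - sqrt v with
    an error that does not depend on v. *)
Lemma poly_approx_norm X u (B : R) : (forall t, X t -> `|t| <= B) ->
  poly_approx X u -> poly_approx X (fun t => `|u t|).
Proof.
move=> XB Hu e e0; have e2 : 0 < e / 2 by lra.
have [q Hq] := Hu _ e2; have [C0 HC0] : exists C0 : R, forall t,
  `|t| <= B -> `|q.[t]| <= C0.
  by have [C0 HC0] := poly_disk_bound q B; exists C0.
pose C : R := `|C0| + 1; have C1 : 0 < C by rewrite /C; have := normr_ge0 C0;
  lra.
have HC t : X t -> `|q.[t]| <= C.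
  by move=> /XB/HC0; have := ler_norm C0; rewrite /C; lra.
have [m Hm] : exists m, C * (2 / m.+2%:R) <= e / 2.
  pose m := Num.trunc (C * 4 / e); exists m.
  have : C * 4 / e < m.+1%:R.
    by rewrite truncnS_gt.
  rewrite ltr_pdivrMr // => h; rewrite mulrA ler_pdivrMr ?ltr0n //.
  by rewrite (_ : m.+2%:R = m.+1%:R + 1 :> R) ?natr1 //; lra.
exists (C *: (1 - sqrt_iter (2^-1)%:P (1 - (C^-1 *: q) ^+ 2) m)) => t Xt.
have := Hq _ Xt => h1.
suff h2 : `|(C *: (1 - sqrt_iter (2^-1)%:P (1 - (C^-1 *: q) ^+ 2) m)).[t] -
  `|q.[t]| | <= e / 2.
  have := ler_distD `|q.[t]| ((C *: (1 - sqrt_iter (2^-1)%:P (1 - (C^-1 *: q)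
    ^+ 2) m)).[t]) `|u t|.
  have := lerB_dist q.[t] (u t); have := lerB_dist (u t) q.[t].
  rewrite (distrC (u t)) => h3 h4;
    have : `| `|q.[t]| - `|u t| | <= e / 2 by rewrite ler_norml; lra.
  by lra.
apply: le_trans Hm; rewrite hornerZ hornerD hornerN horner_sqrt_iter hornerD
  hornerN.
rewrite hornerC expr2 hornerM hornerZ -expr2.
pose w := `|q.[t]| / C.
have w01 : 0 <= w <= 1 by rewrite divr_ge0 ?(ltW C1) //= ler_pdivrMr // mul1r
  HC.
have w2 : 0 <= w ^+ 2 <= 1 by rewrite exprn_ge0 ?exprn_ile1; case/andP: w01.
have -> : (C^-1 * q.[t]) ^+ 2 = w ^+ 2.
  by rewrite /w !exprMn real_normK ?num_real // mulrC.
have -> : `|q.[t]| = C * w by rewrite /w mulrC divfK // lt0r_neq0.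
rewrite -mulrBr normrM gtr0_norm // ler_pM2l //.
have := sqrt_iter_error m w2; case/andP: (w01) => wge0 _;
  rewrite sqrtr_sqr (ger0_norm wge0).
by rewrite addrAC => h; exact: le_trans h (sqrt_iter1_dist _ _).
Qed.

Lemma poly_approx_ext X u v : (forall t, X t -> u t = v t) ->
  poly_approx X u -> poly_approx X v.
Proof.
move=> uv Hu e /Hu[p Hp]; exists p => t Xt; by rewrite -uv // Hp.
Qed.

Lemma poly_approx_min X u v (B : R) : (forall t, X t -> `|t| <= B) ->
  poly_approx X u -> poly_approx X v ->
  poly_approx X (fun t => Num.min (u t) (v t)).
Proof.
move=> XB Hu Hv; pose w t := 2^-1 * ((u t + v t) + (-1) * `|u t + (-1) * v t|).
apply: (@poly_approx_ext _ w).
  by move=> t _; rewrite /w; case: ltrgtP => [h|h|->];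
    [rewrite ltr0_norm| rewrite gtr0_norm|rewrite (_ :
    v t + -1 * v t = 0) ?normr0]; lra.
apply: poly_approxZ; apply: poly_approxD; first exact: poly_approxD.
by apply: poly_approxZ; apply: poly_approx_norm XB _;
  apply: poly_approxD => //; exact: poly_approxZ.
Qed.

Lemma compact_finite_net X (d : R -> R) : compact X ->
  (forall x, X x -> 0 < d x) ->
  exists l : seq R, (forall x, x \in l -> X x) /\
    forall t, X t -> exists2 x, x \in l & `|t - x| < d x.
Proof.
rewrite compact_cover => cX d0.
have [|x Xx|D DX XD] := cX R X (fun x => ball x (d x)).
- by move=> x Xx; apply: ball_open; exact: d0.
- by exists x => //; exact: ballxx (d0 _ Xx).
exists (finmap.enum_fset D); split => [x xD|t /XD[x xD xt]].
  by have := DX x xD; rewrite inE.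
by exists x => //; rewrite distrC.
Qed.

Lemma compact_choice X (P : R -> R -> Prop) :
  (forall x, X x -> exists2 d, 0 < d & P x d) ->
  exists f : R -> R, forall x, X x -> 0 < f x /\ P x (f x).
Proof.
move=> H; suff /choice[f Hf] : forall x, exists d,
  X x -> 0 < d /\ P x d by exists f.
move=> x; have [Xx|nX] := pselect (X x); last by exists 0.
by have [d ? ?] := H _ Xx; exists d.
Qed.

(* Stone's argument: a finite minimum of the functions
   [t |-> g x + e + L_x |t - x|], each of which dominates g. *)
Theorem weierstrass X g : compact X -> eps_continuous X g -> poly_approx X g.
Proof.
move=> cX cg.
have [B XB] : exists B : R, forall t, X t -> `|t| <= B.
  have [B [_ HB]] := compact_bounded cX.
  by exists (B + 1) => t Xt; apply: (HB (B + 1)) => //; rewrite ltrDl.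
(* Every g t is within 1 of the value at some point of a finite net, and the sum over the net
   dominates each of its terms. *)
have [M M0 Mg] : exists2 M : R, 0 <= M & forall t, X t -> `|g t| <= M.
  have [f Hf] := compact_choice (fun x Xx => cg x Xx 1 ltr01).
  have [l [lX Hl]] := compact_finite_net cX (fun x Xx => proj1 (Hf x Xx)).
  have pos x : 0 <= `|g x| + 1 by rewrite addr_ge0.
  exists (\sum_(x <- l) (`|g x| + 1)); first by rewrite sumr_ge0.
  move=> t Xt; have [x xl tx] := Hl _ Xt; have [_ h] := Hf _ (lX _ xl).
  have := h _ Xt tx; rewrite (big_rem x) //=.
  have : 0 <= \sum_(y <- rem x l) (`|g y| + 1) by rewrite sumr_ge0.
  by have := lerB_dist (g t) (g x); lra.
(* The finite minimum exceeds g by at most 3 e, and its polynomial approximation adds one more e. *)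
move=> e0 e00; pose e : R := e0 / 4; have e1 : 0 < e by rewrite /e; lra.
have [f Hf] := compact_choice (fun x Xx => cg x Xx e e1).
(* With this slope the added term reaches 2 M, a bound for g t - g x, once t is at distance f x,
   beyond which the modulus of continuity says nothing. *)
pose L x := 2 * M / f x.
have L0 x : X x -> 0 <= L x.
  by move=> /Hf[fx _]; rewrite divr_ge0 ?mulr_ge0 // ltW.
(* At distance less than d x from x, the sloped term has risen by less than e. *)
pose d x := Num.min (f x) (e / (L x + 1)).
have d0 x : X x -> 0 < d x.
  move=> Xx; have := L0 _ Xx; have [fx _] := Hf _ Xx.
  by rewrite lt_min fx => ?; rewrite divr_gt0 //; lra.
have [l [lX Hl]] := compact_finite_net cX d0.
pose U x t := (g x + e) + L x * `|t - x|.
have Uapp x : poly_approx X (U x).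
  apply: poly_approxD.
    by apply: poly_approx_ext (poly_approx_horner X (g x + e)%:P) => t _;
      rewrite hornerC.
  apply: poly_approxZ; apply: poly_approx_norm XB _.
  by apply: poly_approx_ext (poly_approx_horner X ('X - x%:P)) => t _;
    rewrite hornerXsubC.
have Ug x t : X x -> X t -> g t <= U x t.
  move=> Xx Xt; have [fx h] := Hf _ Xx; rewrite /U.
  have [tx|tx] := ltP `|t - x| (f x).
    have := h _ Xt tx; have := ler_norm (g t - g x).
    by have := mulr_ge0 (L0 _ Xx) (normr_ge0 (t - x)); lra.
  have : L x * f x <= L x * `|t - x| by rewrite ler_wpM2l // L0.
  rewrite /L divfK ?lt0r_neq0 // => h2.
  have := Mg _ Xt; have := Mg _ Xx; have := ler_norm (g t).
  by have := ler_norm (- g x); rewrite normrN; lra.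
(* The constant M also dominates g, so it can start the minimum. *)
pose V t := foldr (fun x => Num.min (U x t)) M l.
have Vapp : poly_approx X V.
  rewrite /V; elim: (l) => [|x l' IH] /=.
    by apply: poly_approx_ext (poly_approx_horner X M%:P) => t _;
      rewrite hornerC.
  exact: poly_approx_min XB (Uapp x) IH.
have Vg t : X t -> g t <= V t.
  move=> Xt; rewrite /V; elim: (l) lX => [|x l' IH] lX' /=.
    by have := Mg _ Xt; have := ler_norm (g t); lra.
  rewrite le_min; apply/andP; split.
    by apply: Ug => //; apply: lX'; exact: mem_head.
  apply: IH => y yl.
  by apply: lX'; rewrite in_cons yl orbT.
have gV t : X t -> V t <= g t + 3 * e.
  move=> Xt; have [x xl tx] := Hl _ Xt; apply: (@le_trans _ _ (U x t)).
    rewrite /V; elim: (l) xl => //= y l' IH; rewrite in_cons ge_min.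
    by case/orP => [/eqP->|/IH ->]; rewrite ?lexx ?orbT.
  have Xx := lX _ xl; have [fx h] := Hf _ Xx; move: tx;
    rewrite lt_min => /andP[t1 t2].
  have := h _ Xt t1; have := ler_norm (g x - g t); rewrite (distrC (g x)).
  have Lx := L0 _ Xx; move: t2; rewrite ltr_pdivlMr; last by lra.
  by rewrite /U; have := normr_ge0 (t - x); nra.
have [p Hp] := Vapp _ e1; exists p => t Xt.
have := Hp _ Xt; have := Vg _ Xt; have := gV _ Xt.
by rewrite /e !ler_norml; lra.
Qed.

End Weierstrass.

(** * Existence of the continuous functional calculus *)

Section ContinuityOnSpectrum.
Variable R : realType.
Implicit Types (S : set R[i]^o) (g : R[i]^o -> R[i]^o) (l w : R[i]).
Import Normc.

Lemma gt0_complexE l : 0 < l -> l = (complex.Re l)%:C /\ 0 < complex.Re l.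
Proof. by rewrite ltcE /=; case: l => u v /= /andP[/eqP -> ->]. Qed.

(** The balls of [R[i]] have positive complex numbers as radii; these are real, which brings
    continuity back to real radii. *)
Lemma within_continuousP S g : {within S, continuous g} <->
  forall z, S z -> forall e : R, 0 < e -> exists2 d : R, 0 < d &
    forall w, S w -> normc (w - z) < d -> normc (g w - g z) < e.
Proof.
split=> [/subspace_continuousP H z Sz e e0|H].
  have e0C : 0 < e%:C by rewrite ltcR.
  have /cvgrPdist_lt/(_ _ e0C) := H z Sz; rewrite near_withinE.
  case/nbhs_ballP => d /gt0_complexE[-> d0] Hd; exists (complex.Re d) => //.
  move=> w Sw wz; rewrite -ltcR normcE distrC; apply: Hd => //.
  by rewrite -ball_normE /= distrC -normcE ltcR.
apply/subspace_continuousP => z Sz;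
  apply/cvgrPdist_lt => e /gt0_complexE[-> e0].
have [d d0 Hd] := H z Sz _ e0; rewrite near_withinE; apply/nbhs_ballP.
exists d%:C; first by rewrite /= ltcR.
move=> w; rewrite -ball_normE /= distrC -normcE ltcR => wz Sw.
by rewrite distrC -normcE ltcR; exact: Hd.
Qed.

End ContinuityOnSpectrum.

Section FunctionalCalculus.
Variables (R : realType) (A : cstarAlgType R).
Implicit Types (a b c x y z : A) (r s t : R) (l w : R[i]) (p q P Q :
  {poly R[i]}).
Implicit Types (g k : R[i]^o -> R[i]^o).
Import Normc.

Definition real_spectrum a : set R := [set t | spectrum a t%:C].

Lemma spectrum_saE a l : star a = a -> spectrum a l ->
  l = (complex.Re l)%:C /\ real_spectrum a (complex.Re l).
Proof.
move=> sa al; have e : l = (complex.Re l)%:C.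
  by have := spectrum_sa_real sa al; case: (l) => u v /= ->.
by split=> //; rewrite /real_spectrum /= -e.
Qed.

Lemma real_spectrum_compact a : compact (real_spectrum a).
Proof.
apply: (@subclosed_compact _ _ `[- cnorm a, cnorm a]); last first.
- move=> t /spectrum_normc; rewrite normc_real ler_norml /=.
  by rewrite in_itv.
- exact: segment_compact.
move=> t tX; apply: spectrum_closed => e e0.
have [s [Xs]] := tX (ball t e) (nbhsx_ballx t e e0).
rewrite /ball /= => ts; exists s%:C => //.
by rewrite normc_realB distrC.
Qed.

Lemma poly_approx_spectrum a g : star a = a ->
  {within spectrum a, continuous g} -> forall e : R, 0 < e ->
  exists P, forall l, spectrum a l -> normc (P.[l] - g l) <= e.
Proof.
move=> sa /within_continuousP cg e e0; have e2 : 0 < e / 2 by lra.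
have Hre : eps_continuous (real_spectrum a) (fun t => complex.Re (g t%:C)).
  move=> t Xt d /(cg _ Xt)[f f0 Hf]; exists f => // s Xs st.
  have {}st : normc (s%:C - t%:C) < f by rewrite normc_realB.
  apply: le_lt_trans (Hf _ Xs st).
  by have := ler_normRe (g s%:C - g t%:C);
    case: (g s%:C) (g t%:C) => [? ?] [? ?].
have Him : eps_continuous (real_spectrum a) (fun t => complex.Im (g t%:C)).
  move=> t Xt d /(cg _ Xt)[f f0 Hf]; exists f => // s Xs st.
  have {}st : normc (s%:C - t%:C) < f by rewrite normc_realB.
  apply: le_lt_trans (Hf _ Xs st).
  by have := ler_normIm (g s%:C - g t%:C);
    case: (g s%:C) (g t%:C) => [? ?] [? ?].
have [p Hp] := weierstrass (@real_spectrum_compact a) Hre e2.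
have [q Hq] := weierstrass (@real_spectrum_compact a) Him e2.
exists (map_poly (real_complex R) p + 'i *: map_poly (real_complex R) q) => l.
move=> /(spectrum_saE sa)[-> Xl]; set t := complex.Re l in Xl *.
rewrite hornerD hornerZ !horner_map (le_trans (ler_normc_ReIm _)) //.
have := Hp _ Xl; have := Hq _ Xl; case: (g t%:C) => u v /=.
rewrite !(mul0r, mul1r, mulr0, subr0, addr0, add0r, oppr0, sub0r).
by lra.
Qed.

(** The graph of the calculus: a single polynomial is close to g on the spectrum and, evaluated at
    a, close to y. In relational form the algebraic laws need no chosen approximating sequence. *)
Definition cfc_rel a g y := forall e : R, 0 < e -> exists P,
  (forall l, spectrum a l -> normc (P.[l] - g l) <= e) /\
  cnorm (horner_alg a P - y) <= e.

(** The estimate [cnorm_horner_alg_le], applied to P - Q, passes to the limit; it makes the value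
    independent of the approximating polynomials. *)
Lemma cfc_rel_le a g k y z e : star a = a -> 0 <= e ->
  cfc_rel a g y -> cfc_rel a k z ->
  (forall l, spectrum a l -> normc (g l - k l) <= e) -> cnorm (y - z) <= e.
Proof.
move=> sa e0 gy kz gk; apply/ler_addgt0Pl => d d0; have d4 : 0 < d / 4 by lra.
have [P [P1 P2]] := gy _ d4; have [Q [Q1 Q2]] := kz _ d4.
have : cnorm (horner_alg a (P - Q)) <= e + d / 2.
  apply: cnorm_horner_alg_le => // [|l al]; first by lra.
  rewrite hornerD hornerN.
  have -> : P.[l] - Q.[l] = (P.[l] - g l) + (g l - k l) + (k l - Q.[l]).
    by rewrite subrKA subrKA.
  have := ler_normcD (P.[l] - g l + (g l - k l)) (k l - Q.[l]).
  have := ler_normcD (P.[l] - g l) (g l - k l).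
  by have := P1 _ al; have := Q1 _ al; have := gk _ al;
    rewrite (normcB (k l)); lra.
rewrite rmorphB /= => h.
have -> : y - z = (y - horner_alg a P) + (horner_alg a P - horner_alg a Q)
                  + (horner_alg a Q - z) by rewrite subrKA subrKA.
rewrite cnormB in P2.
have := ler_cnormD (y - horner_alg a P + (horner_alg a P - horner_alg a Q))
                   (horner_alg a Q - z).
have := ler_cnormD (y - horner_alg a P) (horner_alg a P - horner_alg a Q).
by lra.
Qed.

Lemma cfc_rel_unique a g k y z : star a = a ->
  cfc_rel a g y -> cfc_rel a k z ->
  (forall l, spectrum a l -> g l = k l) -> y = z.
Proof.
move=> sa gy kz gk; apply/subr0_eq/cnorm_eps_eq0 => e e0.
apply: cfc_rel_le sa (ltW e0) gy kz _ => l /gk ->.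
by rewrite subrr normc0 ltW.
Qed.

Lemma cfc_rel_ex a g : star a = a -> {within spectrum a, continuous g} ->
  exists y, cfc_rel a g y.
Proof.
move=> sa cg.
have [eps [eps0 eps_le small]] : exists eps : nat -> R, [/\ forall m, 0 < eps m,
    forall m m', (m' <= m)%N -> eps m <= eps m' &
    forall e, 0 < e -> exists N, eps N < e].
  exists (fun m => m.+1%:R^-1); split=> [m|m m' mm|e e0].
  - by rewrite invr_gt0 ltr0n.
  - by rewrite lef_pV2 ?posrE ?ltr0n // ler_nat.
  - by exists (Num.trunc e^-1); rewrite invf_plt ?posrE ?ltr0n // truncnS_gt.
have /choice[P HP] : forall m, exists P, forall l, spectrum a l ->
    normc (P.[l] - g l) <= eps m.
  by move=> m; exact: poly_approx_spectrum.
have [e e0|y Hy] := cnorm_complete (fun m => horner_alg a (P m)).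
  have [|N HN] := small (e / 4); first by lra.
  exists N => p q Np Nq; apply: (@le_lt_trans _ _ (e / 2)); last by lra.
  rewrite -rmorphB /=; apply: cnorm_horner_alg_le => // [|l al]; first by lra.
  rewrite hornerD hornerN -(subrKA (g l)) (le_trans (ler_normcD _ _)) //.
  rewrite (normcB (g l)); have := HP p _ al; have := HP q _ al.
  by have := eps_le _ _ Np; have := eps_le _ _ Nq; lra.
exists y => e e0; have [N HN] := small _ e0; have [M HM] := Hy _ e0.
exists (P (maxn N M)); split=> [l al|]; last by rewrite ltW // HM ?leq_maxr.
by rewrite (le_trans (HP _ _ al)) // (le_trans (eps_le _ _ (leq_maxl N M))) //
  ltW.
Qed.

(** Products need bounded factors; g inherits a bound from a nearby polynomial, which is bounded on
    the disk of radius [cnorm a]. *)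
Lemma cfc_rel_bound a g y : cfc_rel a g y ->
  exists2 K, 0 <= K & forall l, spectrum a l -> normc (g l) <= K.
Proof.
move=> /(_ _ ltr01)[P [HP _]].
have [K HK] := poly_disk_bound P (cnorm a)%:C.
exists (normc K + 1) => [|l al]; first by have := normc_ge0 K; lra.
have : normc P.[l] <= normc K.
  rewrite -lecR normcE (le_trans (HK _ _)) // ?ler_norm_normc //.
    by rewrite -normcE lecR; exact: spectrum_normc.
  rewrite normcE ger0_norm // (le_trans (normr_ge0 P.[l])) // HK //.
  by rewrite -normcE lecR; exact: spectrum_normc.
have := ler_normcD (g l - P.[l]) P.[l]; rewrite subrK normcB.
by have := HP _ al; lra.
Qed.

Lemma cfc_relD a g k y z : cfc_rel a g y -> cfc_rel a k z ->
  cfc_rel a (fun l => g l + k l) (y + z).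
Proof.
move=> gy kz e e0; have e2 : 0 < e / 2 by lra.
have [P [P1 P2]] := gy _ e2; have [Q [Q1 Q2]] := kz _ e2.
exists (P + Q); split=> [l al|].
  rewrite hornerD opprD addrACA (le_trans (ler_normcD _ _)) //.
  by have := P1 _ al; have := Q1 _ al; lra.
rewrite rmorphD opprD addrACA (le_trans (ler_cnormD _ _)) //; lra.
Qed.

Lemma cfc_relZ a (c : R[i]) g y : cfc_rel a g y ->
  cfc_rel a (fun l => c * g l) (c *: y).
Proof.
move=> gy e e0; have c1 : 0 < normc c + 1 by have := normc_ge0 c; lra.
have [|P [P1 P2]] := gy (e / (normc c + 1)); first exact: divr_gt0.
have H s : 0 <= s -> s <= e / (normc c + 1) -> normc c * s <= e.
  move=> s0; rewrite ler_pdivlMr //; have := normc_ge0 c; nra.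
exists (c *: P); split=> [l al|].
  by rewrite hornerZ -mulrBr normcM H ?normc_ge0 // P1.
by rewrite linearZ /= mulr_algl -scalerBr cnormZ H ?cnorm_ge0.
Qed.

Lemma cfc_relM a g k y z : cfc_rel a g y -> cfc_rel a k z ->
  cfc_rel a (fun l => g l * k l) (y * z).
Proof.
move=> gy kz e e0.
have [K K0 HK] := cfc_rel_bound gy; have [K' K'0 HK'] := cfc_rel_bound kz.
pose C : R := K + K' + cnorm y + cnorm z + 1.
have y0 := cnorm_ge0 y; have z0 := cnorm_ge0 z.
have C0 : 0 < C by rewrite /C; lra.
pose d := Num.min 1 (e / C).
have d0 : 0 < d by rewrite lt_min ltr01 divr_gt0.
have d1 : d <= 1 by rewrite ge_min lexx.
have dC : d * C <= e by rewrite -ler_pdivlMr // ge_min lexx orbT.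
(* One estimate for both halves of [cfc_rel]: it bounds (P - g) Q + g (Q - k) on the spectrum and
   the analogous sum in the algebra. *)
have H s1 s2 s3 s4 K1 K2 : 0 <= s1 -> 0 <= s4 -> 0 <= K1 -> 0 <= K2 ->
    K1 + K2 + 1 <= C -> s1 <= d -> s2 <= K2 + 1 -> 0 <= s3 -> s3 <= K1 -> s4
      <= d ->
    s1 * s2 + s3 * s4 <= e.
  move=> *; have : s1 * s2 <= d * (K2 + 1) by nra.
  have : s3 * s4 <= K1 * d by nra.
  by nra.
have [P [P1 P2]] := gy _ d0; have [Q [Q1 Q2]] := kz _ d0.
exists (P * Q); split=> [l al|].
  have -> : (P * Q).[l] - g l * k l = (P.[l] - g l) * Q.[l] + g l * (Q.[l] - k
    l).
    by rewrite hornerM mulrBl mulrBr subrKA.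
  rewrite (le_trans (ler_normcD _ _)) // !normcM.
  apply: (H _ _ _ _ K K'); rewrite ?normc_ge0 ?P1 ?Q1 ?HK //;
    first by rewrite /C; lra.
  have := ler_normcD (Q.[l] - k l) (k l); rewrite subrK.
  by have := Q1 _ al; have := HK' _ al; lra.
have -> : horner_alg a (P * Q) - y * z =
    (horner_alg a P - y) * horner_alg a Q + y * (horner_alg a Q - z).
  by rewrite rmorphM /= mulrBl mulrBr subrKA.
rewrite (le_trans (ler_cnormD _ _)) //.
have h1 := ler_cnormM (horner_alg a P - y) (horner_alg a Q).
have h2 := ler_cnormM y (horner_alg a Q - z); apply: le_trans (lerD h1 h2) _.
apply: (H _ _ _ _ (cnorm y) (cnorm z)); rewrite ?cnorm_ge0 //.
  by rewrite /C; lra.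
by have := ler_cnorm_dist (horner_alg a Q) z; lra.
Qed.

Lemma cfc_rel_conj a g y : star a = a -> cfc_rel a g y ->
  cfc_rel a (fun l => conjc (g l)) (star y).
Proof.
move=> sa gy e /gy[P [P1 P2]]; exists (map_poly conjc P); split=> [l al|].
  (* At a real point, conjugating the coefficients conjugates the value. *)
  have [e1 _] := spectrum_saE sa al; rewrite {1}e1 -(conjc_real (complex.Re l)).
  by rewrite -e1 horner_map -rmorphB /= normc_conj P1.
by rewrite -star_horner_alg // -starB cnorm_star.
Qed.

Lemma cfc_rel_horner a P : cfc_rel a (fun l => P.[l]) (horner_alg a P).
Proof.
by move=> e e0; exists P; split=> [l al|]; rewrite subrr ?normc0 ?cnorm0 ltW.
Qed.

(** Since [cfc] is a choice, its laws hold as soon as one calculus exists. The witness sends g to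
    the element related to it by [cfc_rel], and to 0 if there is none. *)
Theorem cfcP a : star a = a -> is_cfc a (cfc a).
Proof.
move=> sa; rewrite /cfc; apply: xgetPex.
exists (fun g => xget 0 (cfc_rel a g)).
have PhiP g : {within spectrum a,
  continuous g} -> cfc_rel a g (xget 0 (cfc_rel a g)).
  by move=> /(cfc_rel_ex sa) ex; exact: xgetPex.
have PhiE g y : cfc_rel a g y -> xget 0 (cfc_rel a g) = y.
  move=> gy; have gx : cfc_rel a g (xget 0 (cfc_rel a g)) by apply: xgetPex;
    exists y.
  exact: cfc_rel_unique sa gx gy _.
split; [|split; [|split; [|split; [|split; [|split]]]]].
- move=> g k /PhiP gy /PhiP kz gk; apply: cfc_rel_unique sa gy kz _ => l al.
  by apply: gk; rewrite inE.
- by move=> g k /PhiP gy /PhiP kz; apply: PhiE; exact: cfc_relD.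
- by move=> c g /PhiP gy; apply: PhiE; exact: cfc_relZ.
- by move=> g k /PhiP gy /PhiP kz; apply: PhiE; exact: cfc_relM.
- by move=> g /PhiP gy; apply: PhiE; exact: cfc_rel_conj.
- apply: PhiE; have := cfc_rel_horner a 1; rewrite rmorph1.
  by congr cfc_rel; apply/funext => l; rewrite hornerC.
- apply: PhiE; have := cfc_rel_horner a 'X; rewrite horner_algX.
  by congr cfc_rel; apply/funext => l; rewrite hornerX.
Qed.

End FunctionalCalculus.

(** * Functional calculus with real functions *)

Section RealContinuity.
Variable R : realType.
Implicit Types (X Y : set R) (u v : R -> R) (r t : R).

Lemma within_eps_continuous X u : {within X,
  continuous u} -> eps_continuous X u.
Proof.
move=> /subspace_continuousP cu x Xx e e0.
have /cvgrPdist_lt/(_ _ e0) := cu x Xx; rewrite near_withinE.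
case/nbhs_ballP => d d0 Hd; exists d => // y Xy yx; rewrite distrC;
  apply: Hd => //.
by rewrite -ball_normE /= distrC.
Qed.

Lemma within_continuous_id X : {within X, continuous (id : R -> R)}.
Proof. by apply: continuous_subspaceT => x; exact: cvg_id. Qed.

Lemma within_continuous_cst X r : {within X, continuous (fun=> r : R)}.
Proof. by apply: continuous_subspaceT => x; exact: cvg_cst. Qed.

Lemma within_continuousD X u v : {within X, continuous u} ->
  {within X, continuous v} -> {within X, continuous (fun t => u t + v t)}.
Proof.
move=> /subspace_continuousP cu /subspace_continuousP cv.
by apply/subspace_continuousP => x Xx; exact: cvgD (cu _ Xx) (cv _ Xx).
Qed.

Lemma within_continuousM X u v : {within X, continuous u} ->
  {within X, continuous v} -> {within X, continuous (fun t => u t * v t)}.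
Proof.
move=> /subspace_continuousP cu /subspace_continuousP cv.
by apply/subspace_continuousP => x Xx; exact: cvgM (cu _ Xx) (cv _ Xx).
Qed.

Lemma within_continuousV X u : {within X, continuous u} ->
  (forall t, X t -> u t != 0) -> {within X, continuous (fun t => (u t)^-1)}.
Proof.
move=> /subspace_continuousP cu u0; apply/subspace_continuousP => x Xx.
by apply: cvgV (cu _ Xx); exact: u0.
Qed.

Lemma within_continuous_sqrt X u : {within X, continuous u} ->
  {within X, continuous (fun t => Num.sqrt (u t))}.
Proof.
move=> /subspace_continuousP cu; apply/subspace_continuousP => x Xx.
by apply: continuous_cvg (cu _ Xx); exact: sqrt_continuous.
Qed.

(** The power is differentiable at positive points; 0 is treated apart, with the radius e^(1/r). *)
Lemma within_continuous_powR X r : 0 < r -> (forall t, X t -> 0 <= t) ->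
  {within X, continuous (fun t => t `^ r)}.
Proof.
move=> r0 X0; apply/subspace_continuousP => x Xx.
have := X0 _ Xx; rewrite le_eqVlt => /orP[/eqP x0|x0]; last first.
  apply: cvg_within_filter.
  have : derivable (@powR R ^~ r) x 1.
    by apply: derivable_powR; rewrite in_itv /= x0.
  by move/derivable1_diffP/differentiable_continuous.
apply/cvgrPdist_lt => e e0; rewrite near_withinE; apply/nbhs_ballP.
exists (e `^ r^-1); first exact: powR_gt0.
move=> y; rewrite -ball_normE /from_subspace /= -x0 powR0 ?gt_eqF // !sub0r
  !normrN => yd Xy.
rewrite ger0_norm ?powR_ge0 //; rewrite ger0_norm ?X0 // in yd.
have := gt0_ltr_powR r0 (X0 _ Xy) (powR_ge0 _ _) yd.
by rewrite -powRrM mulVf ?gt_eqF // powRr1 // ltW.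
Qed.

Lemma within_continuous_norm X u : {within X, continuous u} ->
  {within X, continuous (fun t => `|u t|)}.
Proof.
move=> /subspace_continuousP cu; apply/subspace_continuousP => x Xx.
exact: cvg_norm (cu _ Xx).
Qed.

End RealContinuity.

Section RealCalculus.
Variables (R : realType) (A : cstarAlgType R).
Implicit Types (a b c x y z : A) (r s t : R) (l w : R[i]) (u v : R -> R).
Import Normc.

(** Has the shape of the body of [cpow], so that powers are instances by conversion. *)
Definition real_cfc a u : A := cfc a (fun z : R[i]^o => (u (complex.Re z))%:C).

Lemma real_lift_continuous a u : star a = a ->
  {within real_spectrum a, continuous u} ->
  {within spectrum a, continuous (fun z : R[i]^o => (u (complex.Re z))%:C :
    R[i]^o)}.
Proof.
move=> sa /within_eps_continuous cu; apply/within_continuousP => z az e e0.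
have [zE Xz] := spectrum_saE sa az; have [d d0 Hd] := cu _ Xz _ e0.
exists d => // w aw wz; have [wE Xw] := spectrum_saE sa aw.
rewrite normc_realB; apply: Hd => //; apply: le_lt_trans wz.
by rewrite {2}wE {2}zE normc_realB.
Qed.

Section Laws.
Variable a : A.
Hypothesis sa : star a = a.
Local Notation ccont u := {within real_spectrum a, continuous u}.

Lemma real_cfc_ext u v : ccont u -> ccont v ->
  (forall t, real_spectrum a t -> u t = v t) -> real_cfc a u = real_cfc a v.
Proof.
move=> cu cv uv; have [H _] := cfcP sa.
apply: H; try exact: real_lift_continuous.
by move=> z; rewrite inE => /(spectrum_saE sa)[_ /uv ->].
Qed.

Lemma real_cfcD u v : ccont u -> ccont v ->
  real_cfc a (fun t => u t + v t) = real_cfc a u + real_cfc a v.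
Proof.
move=> cu cv; have [_ [H _]] := cfcP sa.
rewrite /real_cfc -H; try exact: real_lift_continuous.
by congr cfc; apply/funext => z; rewrite rmorphD.
Qed.

Lemma real_cfcM u v : ccont u -> ccont v ->
  real_cfc a (fun t => u t * v t) = real_cfc a u * real_cfc a v.
Proof.
move=> cu cv; have [_ [_ [_ [H _]]]] := cfcP sa.
rewrite /real_cfc -H; try exact: real_lift_continuous.
by congr cfc; apply/funext => z; rewrite rmorphM.
Qed.

Lemma real_cfc_star u : ccont u -> star (real_cfc a u) = real_cfc a u.
Proof.
move=> cu; have [_ [_ [_ [_ [H _]]]]] := cfcP sa.
rewrite /real_cfc -H; try exact: real_lift_continuous.
by congr cfc; apply/funext => z; rewrite conjc_real.
Qed.

Lemma real_cfc_cst r : real_cfc a (fun=> r) = r%:C%:A.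
Proof.
have [_ [_ [H [_ [_ [H1 _]]]]]] := cfcP sa; rewrite -H1 -H; last first.
  exact: (real_lift_continuous sa (@within_continuous_cst _ _ 1)).
by congr cfc; apply/funext => z; rewrite mulr1.
Qed.

Lemma real_cfc_id : real_cfc a id = a.
Proof.
have [H0 [_ [_ [_ [_ [_ H]]]]]] := cfcP sa; rewrite -[RHS]H; apply: H0.
- exact: (real_lift_continuous sa (@within_continuous_id _ _)).
- by apply: continuous_subspaceT => x; exact: cvg_id.
- by move=> z; rewrite inE => /(spectrum_saE sa)[<-].
Qed.

Lemma real_cfcZ r u : ccont u ->
  real_cfc a (fun t => r * u t) = r%:C *: real_cfc a u.
Proof.
move=> cu; rewrite real_cfcM ?real_cfc_cst ?mulr_algl //.
exact: within_continuous_cst.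
Qed.

Lemma real_cfc_invertible u : ccont u ->
  (forall t, real_spectrum a t -> u t != 0) -> invertible (real_cfc a u).
Proof.
move=> cu u0; have cV := within_continuousV cu u0.
exists (real_cfc a (fun t => (u t)^-1)); rewrite -!real_cfcM //.
split; rewrite -(scale1r 1) -(rmorph1 (real_complex R)) -real_cfc_cst;
  apply: real_cfc_ext => [| |t /u0 ?]; rewrite ?mulfV ?mulVf //;
  by [exact: within_continuousM|exact: within_continuous_cst].
Qed.

Lemma real_cfc_spectrum u t : ccont u -> real_spectrum (real_cfc a u) t ->
  exists2 s, real_spectrum a s & u s = t.
Proof.
move=> cu ut; apply: contrapT => H; apply: ut.
have cN := @within_continuous_cst _ (real_spectrum a) (- t).
have -> : real_cfc a u - t%:C%:A = real_cfc a (fun s => u s + - t).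
  by rewrite real_cfcD // real_cfc_cst rmorphN /= scaleNr.
apply: real_cfc_invertible => [|s Xs]; first exact: within_continuousD.
by rewrite subr_eq0; apply/eqP => e; apply: H; exists s.
Qed.

Lemma real_cfc_norm_le u r : ccont u ->
  (forall t, real_spectrum a t -> `|u t| <= r) -> cnorm (real_cfc a u) <= r.
Proof.
move=> cu ur; have n0 := cnorm_ge0 (real_cfc a u).
by case: (sa_norm_in_spectrum (real_cfc_star cu)) => /(real_cfc_spectrum cu)[s
  /ur + e];
  rewrite e ?normrN ger0_norm.
Qed.

Lemma real_cfc_horner (p : {poly R}) :
  real_cfc a (fun t => p.[t]) = horner_alg a (map_poly (real_complex R) p).
Proof.
have cp (q : {poly R}) : ccont (fun t => q.[t]).
  by apply: continuous_subspaceT; exact: continuous_horner.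
elim/poly_ind: p => [|p r IH].
  have := real_cfc_cst 0; rewrite rmorph0 scale0r !rmorph0 => <-.
  by congr real_cfc; apply/funext => t; rewrite horner0.
have -> : (fun t => (p * 'X + r%:P).[t]) = (fun t => p.[t] * t + r).
  by apply/funext => t; rewrite !hornerE.
have ci := @within_continuous_id R (real_spectrum a).
have cc := @within_continuous_cst R (real_spectrum a) r.
rewrite real_cfcD ?real_cfcM //; last exact: within_continuousM.
rewrite IH real_cfc_id real_cfc_cst rmorphD rmorphM /= map_polyX map_polyC /=.
by rewrite rmorphD rmorphM /= horner_algX horner_algC.
Qed.

End Laws.

Lemma horner_alg_intertwine a b x (P : {poly R[i]}) : x * a = b * x ->
  x * horner_alg a P = horner_alg b P * x.
Proof.
move=> xab; elim/poly_ind: P => [|P c IH];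
  first by rewrite !rmorph0 mulr0 mul0r.
rewrite !rmorphD !rmorphM /= !horner_algX !horner_algC mulrDr mulrDl.
by rewrite (mulrA x) IH -(mulrA _ x a) xab mulrA mulr_algl mulr_algr.
Qed.

(** One polynomial approximates u on both spectra at once and is intertwined exactly. With x = a,
    this turns functions of a* a into functions of a a*. *)
Lemma real_cfc_intertwine a b x u : star a = a -> star b = b ->
  {within real_spectrum a `|` real_spectrum b, continuous u} ->
  x * a = b * x -> x * real_cfc a u = real_cfc b u * x.
Proof.
move=> sa sb cu xab; apply/subr0_eq/cnorm_eps_eq0 => e e0.
have x0 := cnorm_ge0 x; pose d := e / (2 * (cnorm x + 1)).
have d0 : 0 < d by apply: divr_gt0 => //; lra.
have dx : 2 * cnorm x * d <= e.
  have : d * (2 * (cnorm x + 1)) = e by rewrite divfK // lt0r_neq0 //; lra.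
  by nra.
have cX : compact (real_spectrum a `|` real_spectrum b).
  by apply: compactU; exact: real_spectrum_compact.
have [p Hp] := weierstrass cX (within_eps_continuous cu) d0.
have H c : star c = c -> real_spectrum c `<=` real_spectrum a `|`
  real_spectrum b ->
    cnorm (real_cfc c u - horner_alg c (map_poly (real_complex R) p)) <= d.
  move=> sc cs; have cuc := continuous_subspaceW cs cu.
  have cp : {within real_spectrum c, continuous (fun t => (-1) * p.[t])}.
    apply: within_continuousM; first exact: within_continuous_cst.
    by apply: continuous_subspaceT; exact: continuous_horner.
  rewrite -real_cfc_horner //.
  have -> : real_cfc c u - real_cfc c (fun t => p.[t]) =
            real_cfc c (fun t => u t + (-1) * p.[t]).
    rewrite real_cfcD // real_cfcZ ?rmorphN ?rmorph1 ?scaleN1r //.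
    by apply: continuous_subspaceT; exact: continuous_horner.
  apply: real_cfc_norm_le => //; first exact: within_continuousD.
  by move=> t /cs Xt; rewrite mulN1r distrC; exact: Hp.
have h1 := H a sa (@subsetUl _ _ _); have h2 := H b sb (@subsetUr _ _ _).
set P := map_poly _ p in h1 h2.
have -> : x * real_cfc a u - real_cfc b u * x =
    x * (real_cfc a u - horner_alg a P) - (real_cfc b u - horner_alg b P) * x.
  by rewrite mulrBr mulrBl (horner_alg_intertwine P xab) opprB addrA subrK.
rewrite (le_trans (ler_cnormB _ _)) //.
have := ler_cnormM x (real_cfc a u - horner_alg a P).
have := ler_cnormM (real_cfc b u - horner_alg b P) x.
by nra.
Qed.

End RealCalculus.

(** * Positivity of a* a *)

Section Positivity.
Variables (R : realType) (A : cstarAlgType R).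
Implicit Types (a b c x y z : A) (r s t : R) (l w : R[i]) (u v : R -> R).
Import Normc.

Definition positive_elt a := star a = a /\ forall t,
  real_spectrum a t -> 0 <= t.

(* The norm characterization of the positive cone, visibly closed under sums *)
Definition cone x := star x = x /\ exists t, cnorm (t%:C%:A - x) <= t.

Lemma cone_sqr x : star x = x -> cone (x * x).
Proof.
move=> sx; split; first by rewrite starM sx.
pose s := cnorm (x * x) + 1; have s0 : 0 < s by have := cnorm_ge0 (x * x);
  rewrite /s; lra.
have xs : cnorm (x * x) <= s by rewrite /s; lra.
exists (2^-1 * s); have := sa_sqr_le sx s0 xs.
have -> : s%:C%:A - (x * x + x * x) =
  ((2^-1 * s)%:C%:A - x * x) + ((2^-1 * s)%:C%:A - x * x).
  rewrite addrACA -opprD; congr (_ - _); rewrite -scalerDl -rmorphD /=.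
  by congr (_%:C%:A); field.
by rewrite cnorm_twice; lra.
Qed.

Lemma coneD x y : cone x -> cone y -> cone (x + y).
Proof.
move=> [sx [t Ht]] [sy [s Hs]]; split; first by rewrite starD sx sy.
exists (t + s); rewrite rmorphD scalerDl opprD addrACA.
by rewrite (le_trans (ler_cnormD _ _)) //; lra.
Qed.

Lemma cone_half x : cone (x + x) -> cone x.
Proof.
move=> [sx [t Ht]]; split.
  by rewrite -(scale_half_twice x) -scalerDr starZr sx.
exists (2^-1 * t); have h : 0 <= (2^-1 : R) by rewrite invr_ge0.
have -> : (2^-1 * t)%:C%:A - x = (2^-1 : R)%:C *: (t%:C%:A - (x + x)).
  by rewrite scalerBr scalerA -rmorphM /= scalerDr scale_half_twice.
by rewrite cnormZr // ler_pM2l // invr_gt0.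
Qed.

(** If s is the real number given by the cone, then s - t is in the spectrum of s - x, so it is at
    most the norm of s - x, hence at most s. *)
Lemma cone_spectrum x t : cone x -> real_spectrum x t -> 0 <= t.
Proof.
move=> [sx [s Hs]] xt; rewrite leNgt; apply/negP => t0.
have : spectrum (s%:C%:A - x) (s - t)%:C.
  move=> i; apply: xt; apply: invertibleN.
  have -> // : - (x - t%:C%:A) = s%:C%:A - x - (s - t)%:C%:A.
  by rewrite rmorphB /= scalerBl !opprB [RHS]addrC subrKA.
move/spectrum_normc; rewrite normc_real.
by have := ler_norm (s - t); lra.
Qed.

Lemma spectrum_opp x l : spectrum x l -> spectrum (- x) (- l).
Proof.
move=> xl i; apply: xl; apply: invertibleN.
by have -> : - (x - l%:A) = - x - (- l)%:A by rewrite scaleNr opprD opprK.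
Qed.

(** Jacobson's identity: if b inverts y x - l, then (x b y - 1)/l inverts x y - l. *)
Lemma spectrum_mulC x y l : l != 0 -> spectrum (x * y) l -> spectrum (y * x) l.
Proof.
move=> l0 xyl [b [b1 b2]]; apply: xyl.
exists (l^-1 *: (x * b * y - 1)); split.
  rewrite -scalerAl; have -> : (x * b * y - 1) * (x * y - l%:A) = l%:A.
    rewrite mulrBl mul1r mulrBr !mulr_algr.
    have -> : x * b * y * (x * y) = x * (b * (y * x)) * y by rewrite !mulrA.
    have -> : b * (y * x) = 1 + l *: b.
      by rewrite -b1 mulrBr mulr_algr subrK.
    rewrite mulrDr mulr1 mulrDl -scalerAr -scalerAl addrK opprB addrC subrK.
    by [].
  by rewrite scalerA mulVf // scale1r.
rewrite -scalerAr; have -> : (x * y - l%:A) * (x * b * y - 1) = l%:A.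
  rewrite mulrBr mulr1 mulrBl !mulr_algl.
  have -> : x * y * (x * b * y) = x * (y * x * b) * y by rewrite !mulrA.
  have -> : y * x * b = 1 + l *: b.
    by rewrite -b2 mulrBl mulr_algl subrK.
  rewrite mulrDr mulr1 mulrDl -scalerAr -scalerAl addrK opprB addrC subrK.
  by [].
by rewrite scalerA mulVf // scale1r.
Qed.

Lemma star_mul_self_sa a : star (star a * a) = star a * a.
Proof. by rewrite starM starK. Qed.

(* [c* c + c c* ] is twice the sum of the squares of the real and imaginary
   parts of [c], so [- c* c >= 0] makes the spectra of both products trivial. *)
Lemma opp_square_star_eq0 c k :
  star k = k -> star c * c = - (k * k) -> k * k = 0.
Proof.
move=> sk ck; pose p := c + star c; pose q : A := 'i *: (c - star c).
have sp : star p = p by rewrite starD starK addrC.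
have sq : star q = q.
  rewrite starZ starB starK (_ : conjc _ = - 'i).
    by rewrite scaleNr -scalerN opprB.
  by apply/eqP; rewrite eq_complex /= oppr0 !eqxx.
have cc : cone (c * star c).
  apply: cone_half.
  have -> : c * star c + c * star c = p * p + q * q + (k * k + k * k).
    have -> : k * k = - (star c * c) by rewrite ck opprK.
    have -> : q * q = - ((c - star c) * (c - star c)).
      by rewrite -scalerAl -scalerAr scalerA -expr2 sqr_i scaleN1r.
    rewrite /p !sqrrD_noncomm !mulrN !mulNr opprK -opprD opprB.
    have e (x y : A) : (x + y) + (y - x) = y + y.
      by rewrite (addrC x) addrACA subrr addr0.
    by rewrite e addrACA addrK.
  by apply: coneD; apply: coneD; exact: cone_sqr.
have skk : star (star c * c) = star c * c by exact: star_mul_self_sa.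
have n0 := cnorm_ge0 (star c * c).
suff /cnorm0_eq0 h : cnorm (star c * c) = 0 by rewrite -[k * k]opprK -ck h
  oppr0.
have pos t : real_spectrum (star c * c) t -> 0 <= t.
  move=> ct; have [->//|t0] := eqVneq t 0.
  apply: cone_spectrum cc _; apply: spectrum_mulC ct.
  by rewrite -(rmorph0 (real_complex R)) (inj_eq (@complexI R)).
have neg t : real_spectrum (star c * c) t -> t <= 0.
  move=> /spectrum_opp; rewrite ck opprK -rmorphN => ct.
  by have := cone_spectrum (cone_sqr sk) ct; rewrite oppr_ge0.
by case: (sa_norm_in_spectrum skk) => [/neg|/pos]; lra.
Qed.

(** Compress a by the negative part m of h = a* a: for c = a m(h) one finds c* c = - m(h)^3, minus a
    self-adjoint square, so m(h)^3 = 0. This excludes negative points of the spectrum. *)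
Theorem positive_star_mul a : positive_elt (star a * a).
Proof.
set h := star a * a; have sh : star h = h by exact: star_mul_self_sa.
split=> // t0 ht0; rewrite leNgt; apply/negP => t00.
pose m t : R := Num.max (- t) 0.
have m0 t : 0 <= m t by rewrite le_max lexx orbT.
have tm t : t * m t = - (m t * m t).
  by rewrite /m; case: (leP (- t) 0) => ?;
    rewrite ?mulr0 ?mulrN ?mulNr ?oppr0 ?opprK.
have cm : {within real_spectrum h, continuous m}.
  have -> : m = fun t => 2^-1 * (`|t| + (-1) * t).
    apply/funext => t; rewrite /m; case: (leP (- t) 0) => ?.
      by rewrite ger0_norm; lra.
    by rewrite ltr0_norm; lra.
  apply: within_continuousM; first exact: within_continuous_cst.
  apply: within_continuousD;
    first exact: (within_continuous_norm (@within_continuous_id _ _)).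
  exact: within_continuousM (@within_continuous_cst _ _ _)
    (@within_continuous_id _ _).
have ci := @within_continuous_id R (real_spectrum h).
have cm2 := within_continuousM cm cm; have cm3 := within_continuousM cm2 cm.
pose k := real_cfc h (fun t => Num.sqrt (m t * m t * m t)).
have ck := within_continuous_sqrt cm3.
have sk : star k = k by exact: real_cfc_star.
have kk : k * k = real_cfc h (fun t => m t * m t * m t).
  rewrite -real_cfcM //; congr real_cfc; apply/funext => t.
  by rewrite -expr2 sqr_sqrtr // !mulr_ge0.
clearbody k; pose c := a * real_cfc h m.
have kk0 : k * k = 0.
  apply: (@opp_square_star_eq0 c) => //.
  rewrite starM real_cfc_star // mulrA -(mulrA (real_cfc h m)) -/h.
  rewrite -{2}(real_cfc_id sh) -!real_cfcM //; last exact: within_continuousM.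
  have -> : (fun t => m t * t * m t) = (fun t => (-1) * (m t * m t * m t)).
    by apply/funext => t; rewrite -mulrA tm mulrN mulN1r mulrA.
  by rewrite real_cfcZ // rmorphN rmorph1 scaleN1r kk.
have cd : {within real_spectrum h, continuous (fun t => t + - t0)}.
  by apply: within_continuousD => //; exact: within_continuous_cst.
have cd2 := within_continuousM cd cd.
have hd : real_cfc h (fun t => t + - t0) = h - t0%:C%:A.
  rewrite real_cfcD ?real_cfc_id ?real_cfc_cst ?rmorphN /= ?scaleNr //.
  exact: within_continuous_cst.
apply: ht0; apply: (@invertible_commMl _ _ _ (h - t0%:C%:A)) => //.
(* Adding the null element m(h)^3 to (h - t0)^2 gives a function without zeros: for t0 < 0 the cube
   is positive at t0, where the square vanishes. *)
rewrite -hd -real_cfcM // -[X in invertible X]addr0 -kk0 kk -real_cfcD //.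
apply: real_cfc_invertible => //; first exact: within_continuousD.
move=> t _; rewrite gt_eqF //;
  have m3 : 0 <= m t * m t * m t by rewrite !mulr_ge0.
have [->|tt0] := eqVneq t t0.
  have mt0 : 0 < m t0 by rewrite lt_max oppr_gt0 t00.
  by rewrite subrr mul0r add0r !mulr_gt0.
by rewrite ltr_pwDl // -expr2 exprn_even_gt0 //= subr_eq0.
Qed.

End Positivity.

(** * Powers, absolute values and states *)

Section RealPowers.
Variable R : realType.
Implicit Types (p r s x y t : R).

(** The graph of x^p lies above its tangent at s. This is Young's inequality with exponents p and
    p/(p - 1), so p = 1 is treated apart; both the power mean inequality and Jensen's inequality for
    states come from it. *)
Lemma powR_tangent p x s : 1 <= p -> 0 <= x -> 0 <= s ->
  p * (x * s `^ (p - 1)) <= x `^ p + (p - 1) * s `^ p.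
Proof.
rewrite le_eqVlt => /orP[/eqP<-|p1] x0 s0.
  by rewrite subrr powRr0 !mulr1 mul1r mul0r addr0 powRr1.
have p0 : 0 < p by lra.
have q0 : 0 < p / (p - 1) by rewrite divr_gt0 //; lra.
have := @conjugate_powR _ x (s `^ (p - 1)) p (p / (p - 1)) x0 (powR_ge0 _ _)
  p0 q0.
have -> : p^-1 + (p / (p - 1))^-1 = 1 by rewrite invfM invrK; field; lra.
move=> /(_ erefl); rewrite -powRrM.
have -> : (p - 1) * (p / (p - 1)) = p by field; lra.
rewrite -(ler_pM2l p0) => /le_trans; apply.
by rewrite le_eqVlt; apply/orP; left; apply/eqP; field; lra.
Qed.

(** The tangent inequalities at the mean s are summed; the linear terms add up to p k s^p. *)
Lemma powR_sum_le (k : nat) p (x : 'I_k -> R) : (0 < k)%N -> 1 <= p ->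
  (forall i, 0 <= x i) ->
  (\sum_i x i) `^ p <= k%:R `^ (p - 1) * \sum_i x i `^ p.
Proof.
move=> k0 p1 x0; have kR : 0 < k%:R :> R by rewrite ltr0n.
have p0 : 0 < p by lra.
pose s := (\sum_i x i) / k%:R;
  have s0 : 0 <= s by rewrite divr_ge0 ?sumr_ge0 ?ltW.
have sk : \sum_i x i = k%:R * s by rewrite mulrC divfK // gt_eqF.
have : \sum_i (p * (x i * s `^ (p - 1))) <= \sum_i (x i `^ p + (p - 1) * s `^
  p).
  by apply: ler_sum => i _; exact: powR_tangent.
rewrite -mulr_sumr -mulr_suml sk big_split /= sumr_const card_ord.
rewrite -mulrA mulr_powRB1 // => h.
have {}h : k%:R * s `^ p <= \sum_i x i `^ p.
  by move: h; rewrite -[X in _ + X]mulr_natl; lra.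
rewrite (powRM _ (ltW kR) s0) -(mulr_powRB1 (ltW kR) p0) -mulrA mulrCA.
by rewrite ler_wpM2l ?powR_ge0.
Qed.

Lemma powRD_le p x y : 1 <= p -> 0 <= x -> 0 <= y ->
  (x + y) `^ p <= 2 `^ (p - 1) * (x `^ p + y `^ p).
Proof.
move=> p1 x0 y0.
have := @powR_sum_le 2 p (fun i => if i == ord0 then x else y) erefl p1.
by rewrite !big_ord_recl !big_ord0 /= !addr0; apply => i; case: ifP.
Qed.

Lemma powR_half_sqr t : 0 <= t -> t `^ 2^-1 * t `^ 2^-1 = t.
Proof. by move=> t0; rewrite powR12_sqrt // -expr2 sqr_sqrtr. Qed.

Lemma powR_mul_self t r : 0 < r -> t `^ r * t `^ r = t `^ (2 * r).
Proof.
move=> r0; rewrite -powRD; first by congr powR; ring.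
by apply/implyP => /eqP; lra.
Qed.

End RealPowers.

Section AbsoluteValue.
Variables (R : realType) (A : cstarAlgType R).
Implicit Types (a x y : A) (r t : R).

Lemma positive_continuous a (u : R -> R) : positive_elt a ->
  {within [set t | 0 <= t], continuous u} ->
  {within real_spectrum a, continuous u}.
Proof. by move=> [_ pa]; apply: continuous_subspaceW. Qed.

Lemma continuous_powR_nneg r : 0 < r ->
  {within [set t : R | 0 <= t], continuous (fun t => t `^ r)}.
Proof. by move=> r0; exact: within_continuous_powR. Qed.

Lemma cpowE a r : cpow a r = real_cfc a (fun t => t `^ r).
Proof. by []. Qed.

Lemma cabsE a : cabs a = real_cfc (star a * a) (fun t => t `^ 2^-1).
Proof. by []. Qed.

Lemma cabs_positive a : positive_elt (cabs a).
Proof.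
have pa := positive_star_mul a; have [sa _] := pa.
have h2 : (0 : R) < 2^-1 by rewrite invr_gt0.
have cu := positive_continuous pa (continuous_powR_nneg h2).
rewrite cabsE; split; first exact: real_cfc_star.
by move=> t /(real_cfc_spectrum sa cu)[s _ <-]; exact: powR_ge0.
Qed.

Lemma cabs_sqr a : cabs a * cabs a = star a * a.
Proof.
have pa := positive_star_mul a; have [sa pos] := pa.
have h2 : (0 : R) < 2^-1 by rewrite invr_gt0.
have cu := positive_continuous pa (continuous_powR_nneg h2).
rewrite cabsE -real_cfcM // -[RHS](real_cfc_id sa); apply: real_cfc_ext => //.
- exact: within_continuousM.
- exact: within_continuous_id.
- by move=> t /pos; exact: powR_half_sqr.
Qed.

Lemma cpow_star a r : positive_elt a -> 0 < r -> star (cpow a r) = cpow a r.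
Proof.
move=> pa r0; have [sa _] := pa.
rewrite cpowE; apply: real_cfc_star => //.
exact: positive_continuous pa (continuous_powR_nneg r0).
Qed.

Lemma cpow_mul_self a r : positive_elt a -> 0 < r ->
  cpow a r * cpow a r = cpow a (2 * r).
Proof.
move=> pa r0; have [sa _] := pa.
have cu := positive_continuous pa (continuous_powR_nneg r0).
rewrite !cpowE -real_cfcM //; congr real_cfc; apply/funext => t.
exact: powR_mul_self.
Qed.

End AbsoluteValue.

(** * Inequalities for a single state *)

Section States.
Variables (R : realType) (A : cstarAlgType R) (f : {linear A -> R[i]^o}).
Hypothesis f_state : states f.
Implicit Types (a b c x y : A) (r s t : R) (u v : R -> R).
Import Normc.

(** The real part is real-linear on the whole algebra, so inequalities can be written in [R] without
    first proving that values are real. *)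
Let F x : R := complex.Re (f x : R[i]).

Lemma state_pos x : 0 <= F (star x * x) /\ complex.Im (f (star x * x) :
  R[i]) = 0.
Proof.
have [_ fp _ _] := f_state; have := fp x; rewrite lecE /= => /andP[/eqP -> ->].
by [].
Qed.

Lemma state_linD x y : f (x + y) = (f x + f y :> R[i]).
Proof. exact: linearD. Qed.

Lemma state_linZ (l : R[i]) x : f (l *: x) = (l * f x :> R[i]).
Proof. exact: linearZ. Qed.

Lemma stateD x y : F (x + y) = F x + F y.
Proof. by rewrite /F state_linD ReD. Qed.

Lemma stateZ r x : F (r%:C *: x) = r * F x.
Proof. by rewrite /F state_linZ ReZ_real. Qed.

Lemma stateB x y : F (x - y) = F x - F y.
Proof.
rewrite stateD -(scaleN1r y) -(rmorph1 (real_complex R)) -rmorphN stateZ.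
by rewrite mulN1r.
Qed.

Lemma state_sum k (x : 'I_k -> A) : F (\sum_i x i) = \sum_i F (x i).
Proof.
apply: (big_morph F stateD).
by rewrite -(scale0r 0) -(rmorph0 (real_complex R)) stateZ mul0r.
Qed.

Lemma state1 : F 1 = 1.
Proof. by have [_ _ _ f1] := f_state; rewrite /F f1. Qed.

Lemma state_real r : F (r%:C%:A) = r.
Proof. by rewrite stateZ state1 mulr1. Qed.

(** The discriminant argument for the form f(x* y). Positivity is given only on elements
    [star a * a], so the Hermitian symmetry of the form is derived first. *)
Lemma state_cauchy_schwarz x y :
  normc (f (star x * y)) ^+ 2 <= F (star x * x) * F (star y * y).
Proof.
pose g : R[i] := f (star x * y); pose g' : R[i] := f (star y * x).
have expand (l : R[i]) : f (star (x + l *: y) * (x + l *: y)) =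
   (f (star x * x) + l * g + (conjc l * g' + conjc l * (l * f (star y * y)))
     :> R[i]).
  rewrite starD starZ mulrDl !mulrDr -!scalerAl -!scalerAr scalerA.
  by rewrite !state_linD !state_linZ mulrA.
have [a0 aI] := state_pos x; have [b0 bI] := state_pos y.
have g'E : g' = conjc g.
  have := (state_pos (x + 1 *: y)).2; rewrite expand.
  have := (state_pos (x + 'i *: y)).2; rewrite expand.
  move: aI bI; case: (f (star x * x) : R[i]) => a a' /= ->.
  case: (f (star y * y) : R[i]) => b b' /= ->.
  clear expand; move: (g) (g') => [u v] [u' v'] /= h1 h2.
  by apply/eqP; rewrite eq_complex /=; apply/andP; split; apply/eqP; lra.
have quad s : 0 <= F (star x * x) - 2 * s * normc g ^+ 2
                   + s ^+ 2 * normc g ^+ 2 * F (star y * y).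
  have := (state_pos (x + (- s%:C * conjc g) *: y)).1; rewrite /F expand g'E.
  rewrite normc_sqr; move: bI; case: (f (star x * x) : R[i]) => a a' /=.
  case: (f (star y * y) : R[i]) => b b' /= ->.
  by clear expand; case: (g) => u v /= h; apply: le_trans h _;
    rewrite le_eqVlt; apply/orP; left; apply/eqP; ring.
rewrite -/g; move: quad a0 b0; set a := F (star x * x); set b := F (star y * y).
set n2 := normc g ^+ 2 => quad a0; have n20 : 0 <= n2 by exact: sqr_ge0.
rewrite le_eqVlt => /orP[/eqP b0|b0].
  rewrite -b0 mulr0 leNgt; apply/negP => n2p; have := quad ((a + 1) / n2).
  by rewrite -b0 mulr0 addr0 -mulrA divfK ?gt_eqF //; lra.
have := quad b^-1.
have -> : a - 2 * b^-1 * n2 + b^-1 ^+ 2 * n2 * b = a - n2 / b by field;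
  rewrite gt_eqF.
by rewrite subr_ge0 ler_pdivrMr.
Qed.

Lemma state_norm_le x : normc (f x) <= cnorm x.
Proof.
have [[M fM] _ fn _] := f_state.
have ball1 y : cnorm y <= 1 -> normc (f y) <= 1.
  move=> y1; rewrite -fn /dual_norm; apply: ub_le_sup; last by exists y.
  exists `|M| => _ [z z1 <-]; rewrite (le_trans (fM z)) //.
  rewrite (le_trans (ler_norm _)) // normrM ler_piMr //.
  by rewrite ger0_norm ?cnorm_ge0.
have [x0|x0] := eqVneq (cnorm x) 0.
  by rewrite x0 (cnorm0_eq0 _ x0) linear0 normc0.
have xp : 0 < cnorm x by rewrite lt_def x0 cnorm_ge0.
have := ball1 ((cnorm x)^-1%:C *: x).
rewrite cnormZr ?invr_ge0 ?cnorm_ge0 // mulVf // state_linZ normcM normc_real.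
rewrite ger0_norm ?invr_ge0 ?cnorm_ge0 // mulrC ler_pdivrMr // mul1r.
by apply.
Qed.

Lemma state_le_cnorm x : F x <= cnorm x.
Proof.
by rewrite (le_trans (ler_norm _)) // (le_trans (ler_normRe _)) //
  state_norm_le.
Qed.

Section Calculus.
Variable a : A.
Hypothesis sa : star a = a.
Local Notation ccont u := {within real_spectrum a, continuous u}.

Lemma state_real_cfc_ge0 u : ccont u ->
  (forall t, real_spectrum a t -> 0 <= u t) -> 0 <= F (real_cfc a u).
Proof.
move=> cu u0; have cs := within_continuous_sqrt cu.
have -> : real_cfc a u =
    star (real_cfc a (fun t => Num.sqrt (u t))) * real_cfc a (fun t =>
      Num.sqrt (u t)).
  rewrite real_cfc_star // -real_cfcM //; apply: real_cfc_ext => //.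
    exact: within_continuousM.
  by move=> t /u0 ut; rewrite -expr2 sqr_sqrtr.
by case: (state_pos (real_cfc a (fun t => Num.sqrt (u t)))).
Qed.

Lemma state_real_cfc_le u v : ccont u -> ccont v ->
  (forall t, real_spectrum a t -> u t <= v t) ->
  F (real_cfc a u) <= F (real_cfc a v).
Proof.
move=> cu cv uv; have c1 := @within_continuous_cst R (real_spectrum a) (-1).
have cN := within_continuousM c1 cu; rewrite -subr_ge0 -stateB.
have -> : real_cfc a v - real_cfc a u = real_cfc a (fun t => v t + (-1) * u t).
  by rewrite real_cfcD // real_cfcZ // rmorphN rmorph1 scaleN1r.
apply: state_real_cfc_ge0; first exact: within_continuousD.
by move=> t /uv; rewrite mulN1r subr_ge0.
Qed.

Lemma state_jensen u p : 1 <= p -> ccont u -> ccont (fun t => u t `^ p) ->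
  (forall t, real_spectrum a t -> 0 <= u t) ->
  F (real_cfc a u) `^ p <= F (real_cfc a (fun t => u t `^ p)).
Proof.
move=> p1 cu cp u0; have s0 := state_real_cfc_ge0 cu u0.
set s := F (real_cfc a u) in s0 *.
have cc r := @within_continuous_cst R (real_spectrum a) r.
have c1 : ccont (fun t => p * s `^ (p - 1) * u t) by exact: within_continuousM.
have c2 : ccont (fun t => u t `^ p + (p - 1) * s `^ p) by exact:
  within_continuousD.
have : F (real_cfc a (fun t => p * s `^ (p - 1) * u t)) <=
       F (real_cfc a (fun t => u t `^ p + (p - 1) * s `^ p)).
  apply: state_real_cfc_le => // t /u0 ut.
  by rewrite -mulrA (mulrC (s `^ _)); exact: powR_tangent.
rewrite real_cfcZ // stateZ real_cfcD // real_cfc_cst // stateD state_real -/s.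
rewrite -mulrA (mulrC (s `^ _)) mulr_powRB1 //; last by lra.
by lra.
Qed.

End Calculus.

(* Apply Cauchy-Schwarz to [a = (a w^-1) w] with [w ^+ 2 = |a| + e]; moving [a]
   across the calculus bounds [a (|a| + e)^-1 a* ] by |a* |. *)
Lemma state_mixed_schwarz a :
  normc (f a) ^+ 2 <= F (cabs a) * F (cabs (star a)).
Proof.
pose h := star a * a; pose h' := a * star a.
have ph : positive_elt h by exact: positive_star_mul.
have ph' : positive_elt h' by have := positive_star_mul (star a); rewrite starK.
have [sh hpos] := ph; have [sh' hpos'] := ph'.
have h2 : (0 : R) < 2^-1 by rewrite invr_gt0.
have crt := @continuous_powR_nneg R _ h2.
have p0 : 0 <= F (cabs a).
  rewrite cabsE; apply: state_real_cfc_ge0 => //.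
    exact: positive_continuous ph crt.
  by move=> t _; exact: powR_ge0.
have q0 : 0 <= F (cabs (star a)).
  rewrite cabsE starK; apply: state_real_cfc_ge0 => //.
    exact: positive_continuous ph' crt.
  by move=> t _; exact: powR_ge0.
have main e : 0 < e -> normc (f a) ^+ 2 <= F (cabs (star a)) * (F (cabs a) + e).
  move=> e0; pose d t := t `^ 2^-1 + e; pose w t := Num.sqrt (d t).
  have d0 t : 0 < d t by rewrite /d ltr_wpDl // powR_ge0.
  have w0 t : 0 < w t by rewrite sqrtr_gt0.
  have ww t : w t * w t = d t by rewrite -expr2 sqr_sqrtr // ltW.
  have cd : {within [set t | 0 <= t], continuous d}.
    by apply: within_continuousD => //; exact: within_continuous_cst.
  have cdV : {within [set t | 0 <= t], continuous (fun t => (d t)^-1)}.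
    by apply: within_continuousV => // t _; rewrite gt_eqF.
  have cw := within_continuous_sqrt cd.
  have cwV : {within [set t | 0 <= t], continuous (fun t => (w t)^-1)}.
    by apply: within_continuousV => // t _; rewrite gt_eqF.
  have kd := positive_continuous ph cd.
  have kw := positive_continuous ph cw; have kwV := positive_continuous ph cwV.
  pose W := real_cfc h w; pose V := real_cfc h (fun t => (w t)^-1).
  have VW : V * W = 1.
    rewrite -real_cfcM // -(scale1r 1) -(rmorph1 (real_complex R))
      -(real_cfc_cst sh).
    by congr real_cfc; apply/funext => t; rewrite mulVf // gt_eqF.
  have sW : star W = W by exact: real_cfc_star.
  have sV : star V = V by exact: real_cfc_star.
  have := state_cauchy_schwarz (V * star a) W.
  rewrite starM starK sV -(mulrA a V W) VW mulr1 => /le_trans; apply.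
  have -> : star W * W = cabs a + e%:C%:A.
    rewrite sW cabsE -real_cfcM // -(real_cfc_cst sh) -real_cfcD //.
    - by congr real_cfc; apply/funext => t; rewrite ww.
    - exact: positive_continuous ph crt.
    - exact: within_continuous_cst.
  rewrite stateD state_real; apply: ler_wpM2r; first by rewrite addr_ge0 // ltW.
  have -> : a * V * (V * star a) = real_cfc h' (fun t => (d t)^-1 * t).
    rewrite mulrA -(mulrA a) -real_cfcM //.
    have -> : (fun t => (w t)^-1 * (w t)^-1) = (fun t => (d t)^-1).
      by apply/funext => t; rewrite -invfM ww.
    rewrite (@real_cfc_intertwine _ _ h h') //; last by rewrite mulrA.
      rewrite -mulrA -[X in _ * X](real_cfc_id sh') -real_cfcM //.
        exact: positive_continuous ph' cdV.
      exact: within_continuous_id.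
    by apply: continuous_subspaceW cdV => t [/hpos|/hpos'].
  rewrite cabsE starK; apply: state_real_cfc_le => //.
  - apply: within_continuousM; first exact: positive_continuous ph' cdV.
    exact: within_continuous_id.
  - exact: positive_continuous ph' crt.
  - move=> t /hpos' t0; rewrite mulrC ler_pdivrMr // /d mulrDr powR_half_sqr //.
    by rewrite lerDl mulr_ge0 ?powR_ge0 // ltW.
apply/ler_addgt0Pl => e e0; set q := F (cabs (star a)) in q0 main *.
have q1 : 0 < q + 1 by lra.
have := main _ (divr_gt0 e0 q1); rewrite mulrDr => /le_trans; apply.
rewrite [leRHS]addrC (mulrC q (F (cabs a))) lerD2l mulrA ler_pdivrMr //; nra.
Qed.

Lemma state_buzano x y : star x = x -> star y = y ->
  2 * (F x * F y) <= normc (f (x * y)) + Num.sqrt (F (x * x) * F (y * y)).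
Proof.
move=> sx sy; pose z := (2 * F x)%:C%:A - x.
have sz : star z = z by rewrite starB starZr star1 sx.
have zz : F (star z * z) = F (x * x).
  rewrite sz /z mulrBl !mulrBr !mulr_algl mulr_algr !stateB !stateZ state1.
  by ring.
have := state_cauchy_schwarz z y; rewrite zz sy sz => cs.
have {}cs : normc (f (z * y)) <= Num.sqrt (F (x * x) * F (y * y)).
  by rewrite -[leLHS](ger0_norm (normc_ge0 _)) -sqrtr_sqr ler_wsqrtr.
have -> : 2 * (F x * F y) = F (z * y) + F (x * y).
  by rewrite /z mulrBl mulr_algl stateB stateZ subrK mulrA.
have := ler_normRe (f (z * y)); have := ler_normRe (f (x * y)).
have := ler_norm (F (z * y)); have := ler_norm (F (x * y)); rewrite /F.
lra.
Qed.

Lemma state_ge0_star x : 0 <= F (star x * x).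
Proof. exact: (state_pos x).1. Qed.

Lemma state_sum_sqr k (x : 'I_k -> A) :
  F (star (\sum_i x i) * (\sum_i x i)) <= k%:R * \sum_i F (star (x i) * x i).
Proof.
set S := \sum_i x i.
have : 0 <= \sum_i \sum_j F (star (x i - x j) * (x i - x j)).
  by apply: sumr_ge0 => i _; apply: sumr_ge0 => j _; exact: state_ge0_star.
pose B := \sum_i F (star (x i) * x i).
have -> : \sum_i \sum_j F (star (x i - x j) * (x i - x j)) =
    (k%:R * B + k%:R * B) - (F (star S * S) + F (star S * S)).
  have term i j : F (star (x i - x j) * (x i - x j)) =
      (F (star (x i) * x i) + F (star (x j) * x j)) -
      (F (star (x i) * x j) + F (star (x j) * x i)).
    by rewrite starB mulrBl !mulrBr !stateB; ring.
  under eq_bigr do under eq_bigr do rewrite term.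
  have SS : F (star S * S) = \sum_i \sum_j F (star (x i) * x j).
    rewrite /S star_sum mulr_suml state_sum; apply: eq_bigr => i _.
    by rewrite mulr_sumr state_sum.
  under eq_bigr do rewrite sumrB !big_split /=.
  rewrite sumrB !big_split /= -SS [X in _ - (_ + X)]exchange_big /= -SS.
  congr (_ + _ - _).
    under eq_bigr do rewrite sumr_const card_ord -mulr_natl.
    by rewrite -mulr_sumr.
  by rewrite sumr_const card_ord [RHS]mulr_natl.
by rewrite -/B; lra.
Qed.

End States.

Section NumericalRadius.
Variables (R : realType) (A : cstarAlgType R).
Implicit Types (a x : A) (f : {linear A -> R[i]^o}).
Import Normc.

Lemma state_le_numrad f x : states f -> normc (f x) <= numrad x.
Proof.
move=> fs; apply: ub_le_sup; last by exists f.
by exists (cnorm x) => _ [g gs <-]; exact: state_norm_le.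
Qed.

Lemma numrad_ge0 x : 0 <= numrad x.
Proof.
have [E|/set0P[f fs]] := eqVneq (@states R A) set0.
  by rewrite /numrad E image_set0 sup0.
exact: le_trans (normc_ge0 _) (state_le_numrad x fs).
Qed.

Lemma state_normc_powR f a (n : R) : states f -> 1 <= n ->
  normc (f a) `^ (4 * n) <=
    2^-1 * normc (f (cpow (cabs a) (2 * n) * cpow (cabs (star a)) (2 * n))) +
    4^-1 * complex.Re (f (cpow (cabs a) (4 * n) +
                          cpow (cabs (star a)) (4 * n)) : R[i]).
Proof.
move=> fs hn; have n2 : 1 <= 2 * n by lra.
have n20 : 0 < 2 * n by lra.
have p4 : positive_elt (cabs a) by exact: cabs_positive.
have q4 : positive_elt (cabs (star a)) by exact: cabs_positive.
have pge (b : A) (r : R) : positive_elt b -> 0 < r ->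
    0 <= complex.Re (f (cpow b r) : R[i]).
  move=> pb r0; have [sb pos] := pb; rewrite cpowE;
    apply: (state_real_cfc_ge0 fs sb).
    exact: positive_continuous pb (continuous_powR_nneg r0).
  by move=> t _; exact: powR_ge0.
have jensen (b : A) : positive_elt b ->
    complex.Re (f b : R[i]) `^ (2 * n) <= complex.Re (f (cpow b (2 * n)) :
      R[i]).
  move=> pb; have [sb pos] := pb.
  rewrite -{1}(real_cfc_id sb); apply: (state_jensen fs sb) => //.
    exact: within_continuous_id.
  exact: positive_continuous pb (continuous_powR_nneg n20).
set x := cpow (cabs a) (2 * n); set y := cpow (cabs (star a)) (2 * n).
have sx : star x = x by exact: cpow_star.
have sy : star y = y by exact: cpow_star.
have xx : x * x = cpow (cabs a) (4 * n).
  by rewrite cpow_mul_self //; congr cpow; ring.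
have yy : y * y = cpow (cabs (star a)) (4 * n).
  by rewrite cpow_mul_self //; congr cpow; ring.
have p0 : 0 <= complex.Re (f (cabs a) : R[i]).
  have [sp pos] := p4; rewrite -(real_cfc_id sp).
  by apply: (state_real_cfc_ge0 fs sp) => //; exact: within_continuous_id.
have q0 : 0 <= complex.Re (f (cabs (star a)) : R[i]).
  have [sp pos] := q4; rewrite -(real_cfc_id sp).
  by apply: (state_real_cfc_ge0 fs sp) => //; exact: within_continuous_id.
have h1 : normc (f a) `^ (4 * n) <= complex.Re (f x :
  R[i]) * complex.Re (f y : R[i]).
  have -> : 4 * n = 2 * (2 * n) by ring.
  rewrite powRrM powR_mulrn ?normc_ge0 //.
  have ms := state_mixed_schwarz fs a.
  have := ge0_ler_powR (ltW n20) _ _ ms; rewrite !nnegrE sqr_ge0 mulr_ge0 //.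
  move=> /(_ erefl erefl) /le_trans; apply.
  by rewrite powRM // ler_pM ?powR_ge0 // jensen.
apply: le_trans h1 _.
have := state_buzano fs sx sy; rewrite xx yy (stateD f).
set X := complex.Re (f (cpow (cabs a) (4 * n)) : R[i]).
set Y := complex.Re (f (cpow (cabs (star a)) (4 * n)) : R[i]).
have X0 : 0 <= X by apply: pge => //; lra.
have Y0 : 0 <= Y by apply: pge => //; lra.
have : Num.sqrt (X * Y) <= 2^-1 * (X + Y).
  rewrite -(@ler_pXn2r _ 2) ?nnegrE ?sqrtr_ge0 //; last by lra.
  rewrite sqr_sqrtr ?mulr_ge0 //; have := sqr_ge0 (X - Y); nra.
lra.
Qed.

Lemma state_modulus_powR f a (n : R) : states f -> 1 <= n ->
  complex.Re (f (star a * a) : R[i]) `^ (4 * n) <=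
    complex.Re (f (cpow (cabs a) (8 * n)) : R[i]).
Proof.
move=> fs hn; have n8 : 0 < 8 * n by lra.
have pp := cabs_positive a; have [sp pos] := pp.
have ci := @within_continuous_id R (real_spectrum (cabs a)).
have c2 := within_continuousM ci ci.
have e t : real_spectrum (cabs a) t -> t `^ (8 * n) = (t * t) `^ (4 * n).
  move=> /pos t0; rewrite powRM // powR_mul_self; last by lra.
  by congr powR; ring.
have c8 := positive_continuous pp (continuous_powR_nneg n8).
have c4 : {within real_spectrum (cabs a),
  continuous (fun t => (t * t) `^ (4 * n))}.
  by apply: subspace_eq_continuous c8 => t; rewrite inE => /e.
rewrite cpowE (real_cfc_ext sp c8 c4 e) -cabs_sqr -{1 2}(real_cfc_id sp).
rewrite -real_cfcM //; apply: (state_jensen fs sp) => //; first by lra.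
by move=> t _; rewrite -expr2 sqr_ge0.
Qed.

End NumericalRadius.

(** * The inequality *)

Theorem theorem3p24 (R : realType) (A : cstarAlgType R) (k : nat)
    (hk : (0 < k)%N) (a : 'I_k -> A) (n : R) (hn : 1 <= n) :
  dwrad (\sum_(i < k) a i) `^ (4 * n) <=
    2 `^ (2 * n - 2) * k%:R `^ (4 * n - 1) *
      \sum_(i < k) numrad (cpow (cabs (a i)) (2 * n) *
                           cpow (cabs (star (a i))) (2 * n))
    + 2 `^ (2 * n - 3) * k%:R `^ (4 * n - 1) *
      cnorm (\sum_(i < k) (cpow (cabs (a i)) (4 * n) +
                           cpow (cabs (star (a i))) (4 * n)))
    + 2 `^ (2 * n - 1) * k%:R `^ (8 * n - 1) *
      cnorm (\sum_(i < k) cpow (cabs (a i)) (8 * n)).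
Proof.
set W := \sum_(i < k) numrad _; set N1 := cnorm _; set N2 := cnorm _.
set rhs := (X in _ <= X); set S := \sum_(i < k) a i.
have W0 : 0 <= W by apply: sumr_ge0 => i _; exact: numrad_ge0.
have N10 : 0 <= N1 by exact: cnorm_ge0.
have N20 : 0 <= N2 by exact: cnorm_ge0.
have rhs0 : 0 <= rhs by rewrite !addr_ge0 // !mulr_ge0 ?powR_ge0.
have n4 : 0 < 4 * n by lra.
have two d : 2 `^ (d + 1) = 2 * 2 `^ d :> R.
  by rewrite powRD ?powRr1 1?mulrC //; apply/implyP.
suff H f : states f ->
    Num.sqrt (Normc.normc (f S) ^+ 2 + complex.Re (f (star S * S) : R[i]) ^+ 2)
      `^ (4 * n) <= rhs.
  have [E|/set0P[f0 f0s]] := eqVneq (@states R A) set0.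
    by rewrite /dwrad E image_set0 sup0 powR0 // gt_eqF.
  have rr : (rhs `^ (4 * n)^-1) `^ (4 * n) = rhs.
    by rewrite -powRrM mulVf ?gt_eqF // powRr1.
  have bnd f : states f ->
      Num.sqrt (Normc.normc (f S) ^+ 2 + complex.Re (f (star S * S) :
        R[i]) ^+ 2)
        <= rhs `^ (4 * n)^-1.
    have e1 : 4 * n * (4 * n)^-1 = 1 by rewrite mulfV ?gt_eqF.
    move=> /H h; rewrite -[leLHS]powRr1 ?sqrtr_ge0 // -[X in _ `^ X <= _]e1.
    by rewrite powRrM ge0_ler_powR ?nnegrE ?powR_ge0 // invr_ge0 ltW.
  have ub : ubound [set Num.sqrt (Normc.normc (f S) ^+ 2 +
      complex.Re (f (star S * S) :
        R[i]) ^+ 2) | f in @states R A] (rhs `^ (4 * n)^-1).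
    by move=> _ [f fs <-]; exact: bnd.
  have f0im := @imageP _ _ (fun f : {linear A -> R[i]^o} =>
    Num.sqrt (Normc.normc (f S) ^+ 2 + complex.Re (f (star S * S) :
      R[i]) ^+ 2)) _ _ f0s.
  rewrite -rr; apply: ge0_ler_powR; rewrite ?nnegrE ?powR_ge0 //;
    first exact: ltW.
    apply: le_trans (sqrtr_ge0 _) _; last apply: ub_le_sup f0im.
    by exists (rhs `^ (4 * n)^-1).
  by apply: ge_sup => //; eexists; exact: f0im.
move=> fs; set al := Normc.normc _; set be := complex.Re _.
have al0 : 0 <= al by exact: normc_ge0.
have be0 : 0 <= be by exact: (state_pos fs S).1.
have sq x : 0 <= x -> (x ^+ 2) `^ (2 * n) = x `^ (4 * n).
  move=> x0; rewrite -powR_mulrn // -powRrM; congr powR; ring.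
have hal : al `^ (4 * n) <= k%:R `^ (4 * n - 1) * (2^-1 * W + 4^-1 * N1).
  have : al <= \sum_(i < k) Normc.normc (f (a i)).
    rewrite /al /S raddf_sum -lecR normcE rmorph_sum /=.
    exact: ler_norm_sum.
  move/(ge0_ler_powR (ltW n4));
    rewrite !nnegrE al0 sumr_ge0 => [/(_ erefl erefl)|i _];
    last exact: normc_ge0.
  move/le_trans; apply; apply: le_trans (powR_sum_le hk _ _) _; first by lra.
    by move=> i; exact: normc_ge0.
  rewrite ler_wpM2l ?powR_ge0 //.
  apply: (@le_trans _ _ (\sum_(i < k) (2^-1 * numrad (cpow (cabs (a i)) (2 *
    n) *
      cpow (cabs (star (a i))) (2 * n)) + 4^-1 * complex.Re (f (cpow (cabs (a
        i)) (4 * n) +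
                          cpow (cabs (star (a i))) (4 * n)) : R[i])))).
    apply: ler_sum => i _; apply: le_trans (state_normc_powR (a i) fs hn) _.
    by rewrite lerD2r ler_pM2l ?invr_gt0 // state_le_numrad.
  rewrite big_split /= -!mulr_sumr lerD2l ler_pM2l ?invr_gt0 //.
  by rewrite -(state_sum f) state_le_cnorm.
have hbe : be `^ (4 * n) <= k%:R `^ (8 * n - 1) * N2.
  have kR : 0 < k%:R :> R by rewrite ltr0n.
  have b0 i : 0 <= complex.Re (f (star (a i) * a i) :
    R[i]) by exact: (state_pos fs (a i)).1.
  have := state_sum_sqr fs a; rewrite -/S -/be.
  have B0 : 0 <= \sum_(i < k) complex.Re (f (star (a i) * a i) :
    R[i]) by exact: sumr_ge0.
  move/(ge0_ler_powR (ltW n4)); rewrite !nnegrE be0 (mulr_ge0 (ltW kR) B0).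
  move=> /(_ erefl erefl)/le_trans; apply; rewrite (powRM _ (ltW kR) B0).
  have -> : 8 * n - 1 = 4 * n + (4 * n - 1) by ring.
  rewrite powRD; last by apply/implyP => _; rewrite gt_eqF.
  rewrite -mulrA ler_wpM2l ?powR_ge0 //.
  apply: le_trans (powR_sum_le hk _ b0) _; first by lra.
  rewrite ler_wpM2l ?powR_ge0 //.
  apply: (@le_trans _ _ (\sum_(i < k) complex.Re (f (cpow (cabs (a i)) (8 *
    n)) : R[i]))).
    by apply: ler_sum => i _; exact: state_modulus_powR.
  by rewrite -(state_sum f) state_le_cnorm.
rewrite -sq ?sqrtr_ge0 // sqr_sqrtr ?addr_ge0 ?sqr_ge0 //.
have p1 : 1 <= 2 * n by lra.
apply: le_trans (powRD_le p1 (sqr_ge0 _) (sqr_ge0 _)) _; rewrite !sq //.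
rewrite /rhs; set c := 2 `^ (2 * n - 3).
have -> : 2 `^ (2 * n - 2) = 2 * c by rewrite /c -two; congr powR; ring.
have -> : 2 `^ (2 * n - 1) = 4 * c.
  have -> : 4 * c = 2 * (2 * c) by ring.
  by rewrite /c -!two; congr powR; ring.
have c0 : 0 <= c by exact: powR_ge0.
apply: (@le_trans _ _ (4 * c * (k%:R `^ (4 * n - 1) * (2^-1 * W + 4^-1 * N1)
                                + k%:R `^ (8 * n - 1) * N2))).
  by rewrite ler_wpM2l ?mulr_ge0 // lerD.
by rewrite le_eqVlt; apply/orP; left; apply/eqP; field.
Qed.
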